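(* Let $m$ and $t$ be positive integers with $t\ge 6$ and $\binom{t-1}{3}\le m\le \binom{t-1}{3}+\binom{t-2}{2}$. Let $G$ be a $3$-graph with $m$ edges which contains a subgraph isomorphic to $K_{t-1}^{(3)-}$ but does not contain a subgraph isomorphic to $K_{t-1}^{(3)}$. Then $\lambda(G)<\lambda([t-1]^{(3)})$.
   Context: An $r$-graph $G$ consists of a finite vertex set $V(G)$ (taken to be $[n]=\{1,\dots,n\}$) and an edge set $E(G)\subseteq V(G)^{(r)}$, the family of $r$-element subsets. $K_p^{(r)}$ (also written $[p]^{(r)}$ when on vertex set $[p]$) is the complete $r$-graph on $p$ vertices (a clique of order $p$). $K_{t-1}^{(3)-}$ denotes $K_{t-1}^{(3)}$ with one edge removed. For an $r$-graph $G$ on $[n]$ and $\vec x\in\mathbb R^n$, $\lambda(G,\vec x)=\sum_{i_1\cdots i_r\in E(G)}x_{i_1}\cdots x_{i_r}$, and the Lagrangian is $\lambda(G)=\max\{\lambda(G,\vec x):\vec x\in S\}$ where $S=\{\vec x\in\mathbb R^n: x_i\ge 0,\ \sum_i x_i=1\}$. *)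

(* Defs.v *)
From mathcomp Require Import all_boot all_order all_algebra.
From mathcomp Require Import all_classical all_reals all_analysis.
Import Order.TTheory GRing.Theory Num.Theory.
Import numFieldNormedType.Exports.

Set Implicit Arguments.
Unset Strict Implicit.
Unset Printing Implicit Defensive.

Local Open Scope classical_set_scope.
Local Open Scope ring_scope.

(** The vertex set {1, ..., n} is represented by ['I_n] = {0, ..., n-1}. *)
Record r_graph (r n : nat) := RGraph {
  edges : {set {set 'I_n}};
  edges_uniform : forall e, e \in edges -> #|e| = r }.

Lemma complete_graph_uniform r p (e : {set 'I_p}) :
  e \in [set e : {set 'I_p} | #|e| == r]%SET -> #|e| = r.
Proof. by rewrite inE => /eqP. Qed.

Definition complete_graph (r p : nat) : r_graph r p :=
  RGraph (@complete_graph_uniform r p).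

Lemma del_edge_uniform r n (G : r_graph r n) (e0 e : {set 'I_n}) :
  e \in (edges G :\ e0)%SET -> #|e| = r.
Proof. by rewrite !inE => /andP[_ /edges_uniform]. Qed.

Definition del_edge r n (G : r_graph r n) (e0 : {set 'I_n}) : r_graph r n :=
  RGraph (@del_edge_uniform r n G e0).

(** The image of [H] under the injection [f] is the subgraph of [G] isomorphic
    to [H]; it need not be induced. *)
Definition contains r n k (G : r_graph r n) (H : r_graph r k) : Prop :=
  exists2 f : 'I_k -> 'I_n, injective f &
    forall e : {set 'I_k}, e \in edges H -> (f @: e)%SET \in edges G.

(** All choices of the deleted edge give isomorphic graphs. *)
Definition contains_complete_minus r n (G : r_graph r n) (p : nat) : Prop :=
  exists2 e0, e0 \in edges (complete_graph r p) &
    contains G (del_edge (complete_graph r p) e0).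

Definition simplex (R : realType) (n : nat) : set 'rV[R]_n :=
  [set x | (forall i, 0 <= x ord0 i) /\ \sum_(i < n) x ord0 i = 1].
Arguments simplex : clear implicits.

Definition lagrangian_poly (R : realType) r n (G : r_graph r n)
    (x : 'rV[R]_n) : R :=
  \sum_(e in edges G) \prod_(i in e) x ord0 i.

(** The supremum is a maximum as soon as [0 < n], see [lagrangian_max];
    for [n = 0] the simplex is empty and the value is 0. *)
Definition lagrangian (R : realType) r n (G : r_graph r n) : R :=
  sup [set lagrangian_poly G x | x in simplex R n].

Lemma lagrangian_poly_continuous (R : realType) r n (G : r_graph r n) :
  continuous (lagrangian_poly G : 'rV[R]_n -> R).
Proof.
apply: continuous_big => [|e _]; first exact: add_continuous.
apply: continuous_big => [|i _]; first exact: mul_continuous.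
exact: coord_continuous.
Qed.

Lemma simplex_nonempty (R : realType) n : (0 < n)%N -> simplex R n !=set0.
Proof.
case: n => // n _; exists (delta_mx ord0 ord0); split => [i|].
  by rewrite mxE; case: (_ && _).
rewrite (bigD1 ord0) //= mxE !eqxx big1 ?addr0 // => i /negbTE i0.
by rewrite mxE i0 andbF.
Qed.

Lemma simplex_compact (R : realType) n : compact (simplex R n).
Proof.
have coordC (i : 'I_n) : continuous (fun x : 'rV[R]_n => x ord0 i).
  exact: coord_continuous.
have sumC : continuous (fun x : 'rV[R]_n => \sum_(i < n) x ord0 i).
  by apply: continuous_big => [|i _]; [exact: add_continuous|exact: coordC].
apply: (@subclosed_compact _ _
    [set x : 'rV[R]_n | forall i, `[0, 1]%classic (x ord0 i)]).
- rewrite (_ : simplex R n =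
    \bigcap_i [set x : 'rV[R]_n | 0 <= x ord0 i] `&`
    [set x : 'rV[R]_n | \sum_(i < n) x ord0 i = 1]); last first.
    apply/seteqP; split => x [x0 x1]; split => // i; last exact: x0.
    by move=> _; exact: x0.
  apply: closedI.
    apply: closed_bigI => i _.
    apply: (@preimage_closed _ _ (fun x : 'rV[R]_n => x ord0 i) [set y | 0 <= y]).
      by [].
    exact: closed_ge.
  apply: (@preimage_closed _ _ (fun x : 'rV[R]_n => \sum_(i < n) x ord0 i)
    [set y | y = 1]).
    by move=> x _; exact: sumC.
  exact: closed_eq.
- apply: (@rV_compact R n (fun=> `[0, 1]%classic)) => _.
  exact: segment_compact.
- move=> x [x0 x1] i /=; rewrite in_itv /= x0 -x1 (bigD1 i) //= lerDl.
  by apply: sumr_ge0 => j _; exact: x0.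
Qed.

Lemma lagrangian_max (R : realType) r n (G : r_graph r n) : (0 < n)%N ->
  exists2 x : 'rV[R]_n, simplex R n x &
    lagrangian_poly G x = lagrangian R G /\
    forall y, simplex R n y -> lagrangian_poly G y <= lagrangian R G.
Proof.
move=> n0.
have [x xS xmax] := EVT_max_rV (simplex_nonempty R n0) (@simplex_compact R n)
  (continuous_subspaceT (@lagrangian_poly_continuous R r n G)).
move: xS; rewrite inE => xS.
have ub : ubound [set lagrangian_poly G z | z in simplex R n]
    (lagrangian_poly G x).
  by move=> _ [y yS <-]; apply: xmax; rewrite inE.
have le y : simplex R n y -> lagrangian_poly G y <= lagrangian R G.
  move=> yS; apply: ub_le_sup; first by exists (lagrangian_poly G x).
  by exists y.
exists x => //; split => //; apply/eqP; rewrite eq_le le //=.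
by apply: ge_sup => //; exists (lagrangian_poly G x), x.
Qed.

(* Main.v *)
(** Put p = t - 1, so that K_p has Lagrangian at least
    L = (p-1)(p-2)/(6p^2), and let (E, x) attain the largest Lagrangian lambda,
    assumed >= L, among the 3-graphs with at most C(p,3) + C(p-1,2) edges that
    contain K_p minus an edge on some vertex set P.  Every vertex of positive
    weight has partial derivative at least 3 lambda.  A support of at most p vertices
    is then a p-clique with uniform weights.  Otherwise, compressing along x moves
    P to the p heaviest vertices, and two weighted vertices outside P would need
    more edges than there are outside P.  If just one vertex v, of weight z, lies outside P,
    then p - 1 triples are missing.  Transfer z to the lightest vertex of P and
    let eta be the deviation from the uniform weighting: the change is at most
    the term of order |eta|^2 lost by the clique, provided that the degrees of
    the missing pairs satisfy sum d_i^2 <= p(p-1), which holds because two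
    distinct pairs share at most one vertex.  Hence lambda = L, and equality
    forces weights 1/p on p - 1 vertices and total weight 1/p on two more; then
    the edge bound makes P a clique in every graph attaining L at x. *)

Require Import Defs.
From mathcomp Require Import all_boot all_order all_algebra.
From mathcomp Require Import all_classical all_reals all_analysis.
From mathcomp Require Import fintype finset perm ring lra.
Import Order.TTheory GRing.Theory Num.Theory.
Local Open Scope ring_scope.

Set Implicit Arguments.
Unset Strict Implicit.
Unset Printing Implicit Defensive.

(** * Weights of set families, elementary symmetric polynomials, partial derivatives *)

Definition draws (I : finType) (A : {set I}) k : {set {set I}} :=
  [set e : {set I} | (e \subset A) && (#|e| == k)].

Definition wt (R : realFieldType) (I : finType) (x : I -> R) (e : {set I}) : R :=
  \prod_(i in e) x i.

Definition wsum (R : realFieldType) (I : finType) (x : I -> R)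
    (E : {set {set I}}) : R :=
  \sum_(e in E) wt x e.

(** The elementary symmetric polynomial of degree [k] in the weights on [A]. *)
Definition espoly (R : realFieldType) (I : finType) (x : I -> R) k (A : {set I}) : R :=
  wsum x (draws A k).

(** For a [3]-uniform [E] this is the partial derivative of [wsum x E] in
    direction [c], [wsum x E] being of degree 1 in each variable. *)
Definition link (R : realFieldType) (I : finType) (x : I -> R) (c : I)
    (E : {set {set I}}) : R :=
  \sum_(e in E | c \in e) wt x (e :\ c).

Section FiniteSets.
Variable I : finType.
Implicit Types (A B P e f : {set I}) (E : {set {set I}}).

Lemma drawsP A k e : reflect (e \subset A /\ #|e| = k) (e \in draws A k).
Proof. by rewrite inE; apply: (iffP andP) => -[? /eqP]. Qed.

Lemma card_draws_set A k : #|draws A k| = 'C(#|A|, k).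
Proof. by rewrite -cards_draws; apply: eq_card => e; rewrite !inE. Qed.

Lemma drawsS A B k : A \subset B -> draws A k \subset draws B k.
Proof.
by move=> AB; apply/subsetP => e /drawsP[eA ek]; apply/drawsP; split=> //; apply: subset_trans AB.
Qed.

(** Pascal's rule: split by membership of [v] and delete [v] where it occurs. *)
Lemma sum_drawsU1 (V : nmodType) (F : {set I} -> V) v A k : v \notin A ->
  \sum_(e in draws (v |: A) k.+1) F e =
  \sum_(e in draws A k.+1) F e + \sum_(e in draws A k) F (v |: e).
Proof.
move=> vA; rewrite (bigID (fun e : {set I} => v \in e)) /= addrC; congr (_ + _).
  apply: eq_bigl => e; rewrite !inE; apply/idP/idP.
    case/andP=> /andP[/subsetP eA ->] ve; rewrite andbT.
    apply/subsetP => i ie; have := eA _ ie; rewrite !inE; case: eqP => // iv.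
    by rewrite -iv ie in ve.
  case/andP=> eA ->; rewrite (subset_trans eA (subsetUr _ _)) /=.
  by apply: contra vA => /(subsetP eA).
rewrite [RHS](reindex_onto (fun e => e :\ v) (fun e => v |: e)) /=; last first.
  move=> e /drawsP[eA _]; rewrite setU1K //.
  by apply: contra vA => /(subsetP eA).
apply: eq_big => [e|e /andP[_ ve]]; last by rewrite setD1K.
rewrite !inE; case ve: (v \in e); last first.
  by rewrite andbF; apply/esym/negbTE; rewrite negb_and orbC; apply/orP; left;
    apply/eqP => /setP/(_ v); rewrite !inE eqxx ve.
by rewrite andbT setD1K // eqxx andbT (cardsD1 v e) ve eqSS subDset.

Qed.

Lemma sum_draws0 (V : nmodType) (F : {set I} -> V) A :
  \sum_(e in draws A 0) F e = F set0.
Proof.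
rewrite (big_pred1 set0) // => e; rewrite !inE cards_eq0 andbC.
by case: eqP => // ->; rewrite sub0set.
Qed.

Lemma draws_set0 k : draws (set0 : {set I}) k.+1 = set0.
Proof.
by apply/setP => e; rewrite !inE subset0; case: eqP => // ->; rewrite cards0.
Qed.

Lemma set_ind_U1 (Q : {set I} -> Prop) :
  Q set0 -> (forall v A, v \notin A -> Q A -> Q (v |: A)) -> forall A, Q A.
Proof.
move=> Q0 Q1 A; move: {2}#|A| (erefl #|A|) => k.
elim: k A => [A /eqP|k IH A Ak]; first by rewrite cards_eq0 => /eqP->.
have /set0Pn[v vA] : A != set0 by rewrite -cards_eq0 Ak.
rewrite -(setD1K vA); apply: Q1; first by rewrite !inE eqxx.
by apply: IH; move: Ak; rewrite (cardsD1 v) vA => -[].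
Qed.

End FiniteSets.

Section Weights.
Variables (R : realFieldType) (I : finType).
Implicit Types (A B P e f : {set I}) (E : {set {set I}}) (x : I -> R).

Lemma wt_ge0 x e : (forall i, 0 <= x i) -> 0 <= wt x e.
Proof. by move=> x0; apply: prodr_ge0. Qed.

Lemma wt_U1 x v e : v \notin e -> wt x (v |: e) = x v * wt x e.
Proof. by move=> ve; rewrite /wt big_setU1. Qed.

Lemma wt_D1 x v e : v \in e -> wt x e = x v * wt x (e :\ v).
Proof. by move=> ve; rewrite -[in LHS](setD1K ve) wt_U1 // !inE eqxx. Qed.

Lemma espolyU1 x v A k : v \notin A ->
  espoly x k.+1 (v |: A) = espoly x k.+1 A + x v * espoly x k A.
Proof.
move=> vA; rewrite /espoly /wsum sum_drawsU1 // mulr_sumr; congr (_ + _).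
apply: eq_bigr => e /drawsP[eA _]; rewrite wt_U1 //.
by apply: contra vA => /(subsetP eA).
Qed.

Lemma espoly_0 x A : espoly x 0 A = 1.
Proof. by rewrite /espoly /wsum sum_draws0 /wt big_set0. Qed.

Lemma espoly_set0 x k : espoly x k.+1 set0 = 0.
Proof. by rewrite /espoly draws_set0 /wsum big_set0. Qed.

Lemma espoly1 x A : espoly x 1 A = \sum_(i in A) x i.
Proof.
elim/set_ind_U1: A => [|v A vA IH]; first by rewrite espoly_set0 big_set0.
by rewrite espolyU1 // IH espoly_0 big_setU1 //= mulr1 addrC.
Qed.

(** Newton's identities, here in degree 2 and next in degree 3: once only power sums remain,
    deviations from the mean can be substituted. *)
Lemma espoly2 x A :
  espoly x 2 A = ((\sum_(i in A) x i) ^+ 2 - \sum_(i in A) x i ^+ 2) / 2.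
Proof.
elim/set_ind_U1: A => [|v A vA IH].
  by rewrite espoly_set0 !big_set0; field.
by rewrite espolyU1 // IH espoly1 !big_setU1 //=; field.
Qed.

Lemma espoly3 x A : espoly x 3 A =
  ((\sum_(i in A) x i) ^+ 3
   - 3 * (\sum_(i in A) x i) * (\sum_(i in A) x i ^+ 2)
   + 2 * \sum_(i in A) x i ^+ 3) / 6.
Proof.
elim/set_ind_U1: A => [|v A vA IH].
  by rewrite espoly_set0 !big_set0; field.
by rewrite espolyU1 // IH espoly2 !big_setU1 //=; field.
Qed.

Lemma wsum_le x E E' : (forall i, 0 <= x i) -> E \subset E' -> wsum x E <= wsum x E'.
Proof.
move=> x0 /subsetP EF; rewrite /wsum [leRHS](bigID (fun e => e \in E)) /=.
rewrite -[leLHS]addr0 lerD ?sumr_ge0 // => [|e _]; last exact: wt_ge0.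
by rewrite le_eqVlt; apply/orP; left; apply/eqP; apply: eq_bigl => e;
  case eE: (e \in E); rewrite ?andbF // (EF _ eE).
Qed.

Lemma linkE x c E : link x c E = wsum x [set e :\ c | e in [set e in E | c \in e]].
Proof.
rewrite /wsum big_imset /=; last first.
  move=> e f; rewrite !inE => /andP[_ ce] /andP[_ cf] ef.
  by rewrite -(setD1K ce) ef setD1K.
by rewrite /link; apply: eq_bigl => e; rewrite inE.
Qed.

Lemma link_sub_draws c E k : (forall e, e \in E -> #|e| = k.+1) ->
  [set e :\ c | e in [set e in E | c \in e]] \subset draws (~: [set c]) k.
Proof.
move=> Ek; apply/subsetP => f /imsetP[e]; rewrite inE => /andP[eE ce] ->.
apply/drawsP; split; first by apply/subsetP => i; rewrite !inE => /andP[].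
by have := Ek _ eE; rewrite (cardsD1 c) ce => -[].
Qed.

Lemma link_le_espoly x c E k : (forall i, 0 <= x i) ->
  (forall e, e \in E -> #|e| = k.+1) -> link x c E <= espoly x k (~: [set c]).
Proof. by move=> x0 Ek; rewrite linkE; apply: wsum_le (link_sub_draws _ Ek). Qed.

(** Only first powers of [x c] occur in [wsum], so moving along the line
    [a x + b 1_c] is controlled exactly by [link]. *)
Lemma wsum_line x c E (a b : R) : (forall e, e \in E -> #|e| = 3%N) ->
  wsum (fun i => a * x i + b * (i == c)%:R) E =
  a ^+ 3 * wsum x E + b * a ^+ 2 * link x c E.
Proof.
move=> E3; pose y i := a * x i + b * (i == c)%:R.
have wty e : c \notin e -> wt y e = a ^+ #|e| * wt x e.
  move=> ce; rewrite /wt -prodr_const -big_split /=; apply: eq_bigr => i ie.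
  by rewrite /y (_ : (i == c) = false) ?mulr0 ?addr0 //; apply: contraNF ce => /eqP<-.
rewrite /wsum /link big_mkcondr /= !mulr_sumr -big_split /=; apply: eq_bigr => e eE.
rewrite -/y; case: ifPn => [ce|/wty ->]; last by rewrite E3 // mulr0 addr0.
have := E3 _ eE; rewrite (cardsD1 c) ce => /eqP; rewrite eqSS => /eqP e2.
rewrite (wt_D1 y ce) (wt_D1 x ce) wty ?e2; last by rewrite !inE eqxx.
rewrite /y eqxx mulr1n; ring.
Qed.

End Weights.

(** * Optimality on the simplex and perturbation of the uniform clique weighting *)

Definition in_simplex (R : realFieldType) (I : finType) (x : I -> R) :=
  (forall i, 0 <= x i) /\ \sum_i x i = 1.

(** The value [C(r,3) / r^3] of the uniform weighting on an [r]-clique. *)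
Definition clique_lagrangian (R : realFieldType) (r : R) : R :=
  (r - 1) * (r - 2) / (6 * r ^+ 2).

Section Analysis.
Variables (R : realFieldType) (I : finType).
Implicit Types (A B P e f : {set I}) (E : {set {set I}}) (x : I -> R).

Lemma sum_subr_sqr x A (a : R) : \sum_(i in A) (x i - a) ^+ 2 =
  \sum_(i in A) x i ^+ 2 - 2 * a * (\sum_(i in A) x i) + a ^+ 2 * #|A|%:R.
Proof.
rewrite mulr_natr -sumr_const mulr_sumr -sumrB -big_split.
by apply: eq_bigr => i _ /=; ring.
Qed.

Lemma sum_subr_cube x A (a : R) : \sum_(i in A) (x i - a) ^+ 3 =
  \sum_(i in A) x i ^+ 3 - 3 * a * (\sum_(i in A) x i ^+ 2)
  + 3 * a ^+ 2 * (\sum_(i in A) x i) - a ^+ 3 * #|A|%:R.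
Proof.
rewrite mulr_natr -sumr_const !mulr_sumr -sumrB -big_split -sumrB.
by apply: eq_bigr => i _ /=; ring.
Qed.

(** Cauchy-Schwarz, from the squared deviations from the sum divided by [k]. *)
Lemma sqr_sum_le x A (k : R) : 0 < k -> #|A|%:R <= k ->
  (\sum_(i in A) x i) ^+ 2 <= k * \sum_(i in A) x i ^+ 2.
Proof.
move=> k0 Ak; set S := \sum_(i in A) x i.
have : 0 <= \sum_(i in A) (x i - S / k) ^+ 2.
  by apply: sumr_ge0 => i _; rewrite sqr_ge0.
rewrite sum_subr_sqr -/S.
set Q := \sum_(i in A) x i ^+ 2; set a := #|A|%:R in Ak * => h.
have e1 : (Q - 2 * (S / k) * S + (S / k) ^+ 2 * a) * k =
  k * Q - S ^+ 2 - S ^+ 2 * (1 - a / k) by field; rewrite gt_eqF.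
have h2 : 0 <= S ^+ 2 * (1 - a / k).
  by rewrite mulr_ge0 ?sqr_ge0 // subr_ge0 ler_pdivrMr // mul1r.
have := mulr_ge0 h (ltW k0); rewrite e1; lra.
Qed.

Lemma link_ge0 x c E : (forall i, 0 <= x i) -> 0 <= link x c E.
Proof. by move=> x0; apply: sumr_ge0 => e _; apply: wt_ge0. Qed.

(** One half of the Lagrange multiplier rule: along [(1 + d) x - d 1_c], which stays in the simplex
    for small [d], the value has slope [3 l - D] at [d = 0], with [l] the optimum and [D] the
    link. *)
Lemma link_ge_optimal x E c : (forall e, e \in E -> #|e| = 3%N) ->
  in_simplex x -> (forall y, in_simplex y -> wsum y E <= wsum x E) ->
  0 < x c -> 3 * wsum x E <= link x c E.
Proof.
move=> E3 [x0 x1] xmax xc; set l := wsum x E; set D := link x c E.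
have D0 : 0 <= D by apply: link_ge0.
rewrite leNgt; apply/negP => Dl; have l0 : 0 < l by lra.
have test d : 0 < d -> d <= x c -> (1 + d) ^+ 3 * l - d * (1 + d) ^+ 2 * D <= l.
  move=> d0 dx; have := wsum_line x c (1 + d) (- d) E3.
  have -> : (1 + d) ^+ 3 * l - d * (1 + d) ^+ 2 * D =
    (1 + d) ^+ 3 * l + - d * (1 + d) ^+ 2 * D by ring.
  move=> <-; apply: xmax; split => [i|].
    case: eqP => [->|_]; last by rewrite mulr0 addr0 mulr_ge0 //; lra.
    have : x c <= 1.
      rewrite -x1 (bigD1 c) //= lerDl; apply: sumr_ge0 => j _; exact: x0.
    by move=> xc1; rewrite mulr1n; have := mulr_ge0 (ltW d0) (x0 c); lra.
  rewrite big_split -!mulr_sumr /= x1 (bigD1 c) //= eqxx big1 ?addr0 ?mulr1n; first by ring.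
  by move=> i /negbTE ->.
(* [d <= x c] keeps the weight of [c] nonnegative; the second bound lets the first-order gain
   [3 l - D] dominate the higher powers of [d]. *)
pose d := Num.min (x c) ((3 * l - D) / (12 * l)).
have d0 : 0 < d by rewrite lt_min xc divr_gt0 //; lra.
have dx : d <= x c by rewrite ge_min lexx.
have d1 : d * (12 * l) <= 3 * l - D.
  by rewrite -ler_pdivlMr ?ge_min ?lexx ?orbT //; lra.
have := test d d0 dx.
have -> : (1 + d) ^+ 3 * l - d * (1 + d) ^+ 2 * D =
  l + d * ((3 + 3 * d + d ^+ 2) * l - (1 + d) ^+ 2 * D) by ring.
have d4 : d <= 1 / 4 by nra.
have dl : 0 < d * l by apply: mulr_gt0.
have dD : 0 <= d * D by apply: mulr_ge0 => //; lra.
have : 0 < (3 + 3 * d + d ^+ 2) * l - (1 + d) ^+ 2 * D by nra.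
move=> h; have := mulr_gt0 d0 h; lra.
Qed.

(** Here [z] is the weight of the vertex outside [P] and the subtracted term bounds the weight of
    the missing triples from below. The [d i] are degrees of missing pairs, possibly fractional so
    as to account for a missing triple inside [P]. *)
Lemma clique_perturbation_bound P x (d : I -> R) w (z r lam : R) :
  r = #|P|%:R -> 5 <= r -> w \in P -> 0 < z -> 0 <= x w ->
  (forall i, i \in P -> x w <= x i) ->
  (forall i, i \in P -> x i <= 1 / r + z / (r - 2)) ->
  \sum_(i in P) x i = 1 - z ->
  \sum_(i in P) d i = 2 * (r - 1) -> \sum_(i in P) d i ^+ 2 <= r * (r - 1) ->
  lam <= espoly x 3 P + z * espoly x 2 P
         - z * x w * ((r - 1) * x w + \sum_(i in P) d i * (x i - x w)) ->
  lam <= clique_lagrangian r /\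
  (clique_lagrangian r <= lam ->
   (forall i, i \in P -> i != w -> x i = 1 / r) /\ x w + z = 1 / r).
Proof.
move=> rP r5 wP z0 w0 wmin xub xs ds dq; set h := x w in w0 wmin xs *.
pose y i := if i == w then h + z else x i.
pose eta i := y i - 1 / r.
(* After [z] is moved onto [w], the clique on [P] has value [clique_lagrangian r - B * H2 + H3 / 3],
   with [H2] and [H3] the power sums of [eta]. *)
pose B := (r - 2) / (2 * r).
have r0 : r != 0 by lra.
have r20 : r - 2 != 0 by lra.
have cardA : #|P :\ w|%:R = r - 1 :> R.
  rewrite rP (cardsD1 w P) wP natrD mulr1n; lra.
have hz : h * r <= 1 - z.
  by rewrite -xs rP mulr_natr -sumr_const; apply: ler_sum.
have z1 : z <= 1 by nra.
have B0 : 0 < B by rewrite divr_gt0; lra.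
have etaw : eta w = h + z - 1 / r by rewrite /eta /y eqxx.
have etai i : i \in P :\ w -> eta i = x i - 1 / r.
  by rewrite !inE => /andP[/negbTE iw _]; rewrite /eta /y iw.
have etaub i : i \in P -> 0 < z * B - eta i / 3.
  move=> iP; case: (eqVneq i w) => [->|iw].
    rewrite etaw.
    suff : 0 < (z * B - (h + z - 1 / r) / 3) * (6 * r) by rewrite pmulr_lgt0; lra.
    have -> : (z * B - (h + z - 1 / r) / 3) * (6 * r) =
      z * r - 6 * z + 2 * (1 - h * r) by rewrite /B; field.
    by nra.
  have iA : i \in P :\ w by rewrite !inE iw.
  rewrite etai //; have := xub _ iP.
  suff : z / (r - 2) < 3 * z * B by lra.
  rewrite ltr_pdivrMr; last lra.
  rewrite /B mulrA mulrAC ltr_pdivlMr; last lra.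
  have : 0 < (r - 5) * (3 * r + 1) + 17 by nra.
  move=> k; have := mulr_gt0 z0 k; lra.
pose H2 := \sum_(i in P) eta i ^+ 2; pose H3 := \sum_(i in P) eta i ^+ 3.
have H20 : 0 <= H2 by apply: sumr_ge0 => i _; rewrite sqr_ge0.
pose c := r - 1 - d w.
(* The transfer destroys the triples through both [w] and the outside vertex; [z * h * X] is their
   weight minus the loss term. *)
pose X := \sum_(i in P :\ w) (1 - d i) * eta i + c * eta w - z * c.
(* Termwise AM-GM. The hypothesis on [d i ^+ 2] is exactly what bounds the squared coefficients by
   [2 (r - 2) c], and the [- z * c] in [X] absorbs the result. *)
have zX : z * X <= (r - 2) / 2 * H2.
  have amgm (a t : R) : z * (a * t) <= z ^+ 2 * a ^+ 2 / (2 * (r - 2)) + (r - 2) / 2 * t ^+ 2.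
    rewrite -subr_ge0.
    have -> : z ^+ 2 * a ^+ 2 / (2 * (r - 2)) + (r - 2) / 2 * t ^+ 2 - z * (a * t) =
      (z * a - (r - 2) * t) ^+ 2 / (2 * (r - 2)) by field.
    by rewrite divr_ge0 ?sqr_ge0 //; lra.
  have : z * (X + z * c) <= z ^+ 2 / (2 * (r - 2)) *
     (\sum_(i in P :\ w) (1 - d i) ^+ 2 + c ^+ 2) + (r - 2) / 2 * H2.
    rewrite /X subrK mulrDr mulr_sumr /H2 (big_setD1 w wP) /=.
    apply: (le_trans (lerD (ler_sum _ (fun i _ => amgm _ _)) (amgm _ _))).
    by rewrite big_split /= -mulr_suml -!mulr_sumr; lra.
  have : \sum_(i in P :\ w) (1 - d i) ^+ 2 + c ^+ 2 <= 2 * (r - 2) * c.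
    rewrite (eq_bigr (fun i => (d i - 1) ^+ 2)); last by move=> i _; ring.
    rewrite sum_subr_sqr cardA.
    move: ds dq; rewrite !(big_setD1 w wP) /= /c.
    by set D1 := \sum_(i in _) d i; set D2 := \sum_(i in _) d i ^+ 2; nra.
  move=> h1 h2; suff : z ^+ 2 / (2 * (r - 2)) *
     (\sum_(i in P :\ w) (1 - d i) ^+ 2 + c ^+ 2) <= z ^+ 2 * c by lra.
  rewrite mulrAC ler_pdivrMr; last lra.
  by have := ler_wpM2l (sqr_ge0 z) h1; lra.
(* Since [w] is lightest, [h * r <= 1 - z], so only the fraction [1 - z] of the quadratic loss
   [B * H2] is used up. *)
have hX : z * h * X <= (1 - z) * B * H2.
  have [X0|X0] := lerP X 0.
    apply: (@le_trans _ _ 0); first by rewrite mulr_ge0_le0 // mulr_ge0 // ltW.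
    by rewrite mulr_ge0 // mulr_ge0 ?subr_ge0 // ltW.
  rewrite -(@ler_pM2r _ r); last lra.
  have -> : (1 - z) * B * H2 * r = (1 - z) * ((r - 2) / 2 * H2) by rewrite /B; field.
  have -> : z * h * X * r = h * r * (z * X) by ring.
  apply: ler_pM => //; first by rewrite mulr_ge0 //; lra.
  by rewrite mulr_ge0 // ltW.
have key : espoly x 3 P + z * espoly x 2 P
    - z * h * ((r - 1) * h + \sum_(i in P) d i * (x i - h)) =
    clique_lagrangian r - B * H2 + H3 / 3 + z * h * X.
  rewrite espoly3 espoly2 /H2 /H3 /X !(big_setD1 w wP) /= -/h etaw subrr mulr0 add0r.
  move: xs ds; rewrite !(big_setD1 w wP) /= -/h.
  rewrite [\sum_(i in P :\ w) eta i ^+ 2](eq_bigr (fun i => (x i - 1 / r) ^+ 2)); last first.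
    by move=> i iA; rewrite etai.
  rewrite [\sum_(i in P :\ w) eta i ^+ 3](eq_bigr (fun i => (x i - 1 / r) ^+ 3)); last first.
    by move=> i iA; rewrite etai.
  have -> : \sum_(i in P :\ w) (1 - d i) * eta i =
    \sum_(i in P :\ w) x i - 1 / r * #|P :\ w|%:R - \sum_(i in P :\ w) d i * x i
    + 1 / r * \sum_(i in P :\ w) d i.
    rewrite mulr_natr -sumr_const mulr_sumr -!sumrB -big_split.
    by apply: eq_bigr => i iA /=; rewrite etai //; ring.
  have -> : \sum_(i in P :\ w) d i * (x i - h) =
    \sum_(i in P :\ w) d i * x i - h * \sum_(i in P :\ w) d i.
    by rewrite mulr_sumr -sumrB; apply: eq_bigr => i _; ring.
  rewrite sum_subr_sqr sum_subr_cube cardA /c /B /clique_lagrangian.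
  set T1 := \sum_(i in _) x i; set D1 := \sum_(i in _) d i.
  move=> xs ds; have -> : T1 = 1 - z - h by lra.
  have -> : D1 = 2 * (r - 1) - d w by lra.
  by field; rewrite r0.
rewrite key => lamle.
(* The remaining [z * B * H2] dominates the cubic term summand by summand; strictness in [etaub]
   gives [eta = 0] in the equality case. *)
have cub : z * B * H2 - H3 / 3 = \sum_(i in P) (z * B - eta i / 3) * eta i ^+ 2.
  rewrite /H2 /H3 mulr_sumr mulr_suml -sumrB; apply: eq_bigr => i _.
  by rewrite exprS; ring.
have cub0 i : i \in P -> 0 <= (z * B - eta i / 3) * eta i ^+ 2.
  by move=> iP; rewrite mulr_ge0 ?sqr_ge0 // ltW ?etaub.
have lamle2 : lam <= clique_lagrangian r -
    \sum_(i in P) (z * B - eta i / 3) * eta i ^+ 2 by rewrite -cub; lra.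
split; first by apply: (le_trans lamle2); rewrite gerBl; apply: sumr_ge0.
move=> lamge; have eta0 i : i \in P -> eta i = 0.
  move=> iP; have : (z * B - eta i / 3) * eta i ^+ 2 <= 0.
    apply: le_trans (_ : \sum_(i in P) (z * B - eta i / 3) * eta i ^+ 2 <= 0); last by lra.
    rewrite (bigD1 i) //= lerDl; apply: sumr_ge0 => j /andP[jP _]; exact: cub0.
  rewrite pmulr_rle0 ?etaub // => le0; apply/eqP; rewrite -sqrf_eq0.
  by rewrite eq_le le0 sqr_ge0.
split=> [i iP iw|]; last by have := eta0 _ wP; rewrite etaw; lra.
have iA : i \in P :\ w by rewrite !inE iw.
by have := eta0 _ iP; rewrite etai //; lra.
Qed.

End Analysis.

(** * Small supports, and a bound on the link by the number of edges *)

Section Supports.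
Variables (R : realFieldType) (I : finType).
Implicit Types (A B P T e f : {set I}) (E : {set {set I}}) (x : I -> R).

Lemma bin2R n : 'C(n, 2)%:R = n%:R * (n%:R - 1) / 2 :> R.
Proof.
elim: n => [|n IH]; first by rewrite bin0n /=; field.
by rewrite binS natrD IH bin1 -natr1; field.
Qed.

Lemma bin3R n : 'C(n, 3)%:R = n%:R * (n%:R - 1) * (n%:R - 2) / 6 :> R.
Proof.
elim: n => [|n IH]; first by rewrite bin0n /=; field.
by rewrite binS natrD IH bin2R -natr1; field.
Qed.

Lemma wsum_support x E T k : (forall i, i \notin T -> x i = 0) ->
  (forall e, e \in E -> #|e| = k) -> wsum x E = wsum x (E :&: draws T k).
Proof.
move=> xT Ek; rewrite /wsum (big_setID (draws T k)) /= [X in _ + X]big1 ?addr0 //.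
move=> e; rewrite !inE => /andP[+ eE]; rewrite (Ek _ eE) eqxx andbT.
by move=> /subsetPn[i ie iT]; rewrite (wt_D1 x ie) xT // mul0r.
Qed.

Lemma wsumID x E E' : wsum x E = wsum x (E :&: E') + wsum x (E :\: E').
Proof. exact: big_setID. Qed.

Lemma sum_setC1 x c : in_simplex x -> \sum_(i in ~: [set c]) x i = 1 - x c.
Proof.
move=> [_ <-]; rewrite [in RHS](bigD1 c) //= addrAC subrr add0r.
by apply: eq_bigl => i; rewrite !inE.
Qed.

Lemma link_le x c E : (forall e, e \in E -> #|e| = 3%N) -> in_simplex x ->
  link x c E <= ((1 - x c) ^+ 2 - \sum_(i in ~: [set c]) x i ^+ 2) / 2.
Proof.
move=> E3 xS; rewrite -(sum_setC1 c xS) -espoly2.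
by apply: link_le_espoly => // i; apply: xS.1.
Qed.

(** The link condition and Cauchy-Schwarz over at most [r - 1] other vertices bound each weight by
    [1 / r]. Weights summing to 1 on at most [r] vertices are then uniform, and the value counts the
    triples present. *)
Lemma small_support x E (T : {set I}) (r : R) : 5 <= r ->
  (forall e, e \in E -> #|e| = 3%N) -> in_simplex x ->
  (forall c, 0 < x c -> 3 * wsum x E <= link x c E) ->
  clique_lagrangian r <= wsum x E -> (forall i, (i \in T) = (0 < x i)) ->
  #|T|%:R <= r ->
  [/\ wsum x E = clique_lagrangian r, #|T|%:R = r & draws T 3 \subset E].
Proof.
move=> r5 E3 xS xlink ge supp Tr; have [x0 x1] := xS.
have xT i : i \notin T -> x i = 0.
  by rewrite supp -leNgt => h; apply/eqP; rewrite eq_le h x0.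
have xT1 : \sum_(i in T) x i = 1.
  by rewrite -x1 [RHS](bigID (mem T)) /= [X in _ + X]big1 ?addr0.
have r0 : r != 0 by lra.
have xle i : i \in T -> x i <= 1 / r.
  move=> iT; have xi : 0 < x i by rewrite -supp.
  have xi1 : x i <= 1.
    by rewrite -xT1 (bigD1 i) //= lerDl; apply: sumr_ge0 => j _; exact: x0.
  have := link_le i E3 xS; have := xlink _ xi.
  have : (1 - x i) ^+ 2 <= (r - 1) * \sum_(j in ~: [set i]) x j ^+ 2.
    have -> : \sum_(j in ~: [set i]) x j ^+ 2 = \sum_(j in T :\ i) x j ^+ 2.
      rewrite (big_setID T) /= [X in _ + X]big1 ?addr0.
        by apply: eq_bigl => j; rewrite !inE andbC.
      by move=> j; rewrite !inE => /andP[jT _]; rewrite xT // expr0n.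
    have <- : \sum_(j in T :\ i) x j = 1 - x i.
      by rewrite -xT1 (big_setD1 i iT) /=; lra.
    apply: sqr_sum_le; first by lra.
    by move: Tr; rewrite (cardsD1 i) iT natrD mulr1n; lra.
  set Q := \sum_(j in _) _; set L := link x i E => h1 h2 h3.
  have h4 : ((r - 1) / r) ^+ 2 <= (1 - x i) ^+ 2.
    have h5 : 6 * clique_lagrangian r * (r - 1) <= (1 - x i) ^+ 2 * (r - 2).
      have : 6 * clique_lagrangian r <= (1 - x i) ^+ 2 - Q by lra.
      move=> h; have r10 : 0 <= r - 1 by lra.
      have := ler_wpM2r r10 h; lra.
    rewrite -(@ler_pM2r _ (r - 2)); last lra.
    apply: le_trans h5; rewrite le_eqVlt; apply/orP; left; apply/eqP.
    by rewrite /clique_lagrangian; field.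
  have : (r - 1) / r <= 1 - x i.
    by rewrite -(@ler_pXn2r _ 2) // nnegrE ?divr_ge0 //; lra.
  have -> : (r - 1) / r = 1 - 1 / r by field.
  lra.
have gap : \sum_(i in T) (1 / r - x i) = #|T|%:R / r - 1.
  by rewrite sumrB xT1 sumr_const -[X in X - 1 = _]mulr_natl mul1r.
have gap0 : \sum_(i in T) (1 / r - x i) = 0.
  apply/eqP; rewrite eq_le; apply/andP; split; last first.
    by apply: sumr_ge0 => i iT; rewrite subr_ge0 xle.
  by rewrite gap subr_le0 ler_pdivrMr ?mul1r //; apply: lt_le_trans r5; lra.
have cardT : #|T|%:R = r.
  move: gap0; rewrite gap => /eqP; rewrite subr_eq0 => /eqP h.
  by rewrite -[LHS](divfK r0) h mul1r.
have xr i : i \in T -> x i = 1 / r.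
  move=> iT; have := gap0; rewrite (bigD1 i) //=.
  have : 0 <= \sum_(j in T | j != i) (1 / r - x j).
    by apply: sumr_ge0 => j /andP[jT _]; rewrite subr_ge0 xle.
  have := xle i iT; lra.
have wE : wsum x E = #|E :&: draws T 3|%:R / r ^+ 3.
  rewrite (wsum_support xT E3) /wsum (eq_bigr (fun _ => (1 / r) ^+ 3)).
    by rewrite sumr_const -[LHS]mulr_natl expr_div_n expr1n mul1r.
  move=> e; rewrite !inE => /and3P[_ /subsetP eT /eqP <-].
  by rewrite -prodr_const; apply: eq_bigr => i /eT/xr.
have cL : clique_lagrangian r = #|draws T 3|%:R / r ^+ 3.
  by rewrite card_draws_set bin3R cardT /clique_lagrangian; field.
have sub : #|E :&: draws T 3| = #|draws T 3|.
  apply/eqP; rewrite eqn_leq subset_leq_card ?subsetIr //=.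
  rewrite -(ler_nat R) -(@ler_pM2r _ (r ^+ 3)^-1) -?cL -?wE //.
  by rewrite invr_gt0 exprn_gt0 //; lra.
split=> //; first by rewrite wE cL sub.
by apply/setIidPr/eqP; rewrite eqEcard subsetIr sub leqnn.
Qed.

(** Motzkin-Straus, with the clique number replaced by [1 + sqrt (2 N)] for
    [N] edges. *)
Lemma link_le_card x c E (a : R) : (forall e, e \in E -> #|e| = 3%N) ->
  in_simplex x -> 0 < a ->
  #|[set e in E | c \in e]|%:R <= a ^+ 2 / 2 ->
  2 * (a + 1) * link x c E <= a * (1 - x c) ^+ 2.
Proof.
move=> E3 xS a0 N; have := link_le c E3 xS; set Q := \sum_(i in _) _ => hQ.
have Q0 : 0 <= Q by apply: sumr_ge0 => i _; rewrite sqr_ge0.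
have [Qz|Qn] := eqVneq Q 0.
  have : (1 - x c) ^+ 2 <= #|I|.+1%:R * Q.
    by rewrite -(sum_setC1 c xS); apply: sqr_sum_le; rewrite ?ltr0n // ler_nat leqW // max_card.
  rewrite Qz mulr0 => h; have l0 := link_ge0 c E xS.1.
  have : (1 - x c) ^+ 2 = 0 by apply/eqP; rewrite eq_le h sqr_ge0.
  by move=> h0; rewrite h0 Qz in hQ *; nra.
have {Qn}Q0 : 0 < Q by rewrite lt_def Qn.
(* One bound on the link decreases in [Q], the other increases; adding them with factors [a] and 1
   eliminates [Q]. *)
suff h : link x c E <= a * Q / 2.
  by have := ler_wpM2l (ltW a0) hQ; nra.
rewrite linkE; set L := [set e :\ c | e in _].
have LN : #|L|%:R <= a ^+ 2 / 2.
  by apply: le_trans N; rewrite ler_nat leq_imset_card.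
(* Squared pair weights are terms of the second elementary symmetric polynomial of the squares,
   whose sum is [Q]. *)
have sq : \sum_(f in L) wt x f ^+ 2 <= Q ^+ 2 / 2.
  apply: le_trans (_ : espoly (fun i => x i ^+ 2) 2 (~: [set c]) <= _).
    rewrite /espoly; apply: le_trans (wsum_le _ (link_sub_draws c E3)); last first.
      by move=> i; rewrite sqr_ge0.
    by rewrite /wsum; apply: ler_sum => f _; rewrite /wt prodrXl.
  rewrite espoly2 -/Q ler_pM2r ?invr_gt0 // gerBl.
  by apply: sumr_ge0 => i _; rewrite sqr_ge0.
have : 0 <= \sum_(f in L) (wt x f - Q / a) ^+ 2.
  by apply: sumr_ge0 => f _; rewrite sqr_ge0.
rewrite sum_subr_sqr -/(wsum x L) => h.
have h2 : (Q / a) ^+ 2 * #|L|%:R <= Q ^+ 2 / 2.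
  have -> : Q ^+ 2 / 2 = (Q / a) ^+ 2 * (a ^+ 2 / 2) by field; rewrite gt_eqF.
  by apply: ler_wpM2l; rewrite ?sqr_ge0.
have h3 : 2 * (Q / a) * wsum x L <= Q ^+ 2 by lra.
rewrite -(@ler_pM2l _ (2 * (Q / a))); last by rewrite mulr_gt0 // divr_gt0.
by apply: le_trans h3 _; rewrite le_eqVlt; apply/orP; left; apply/eqP; field; rewrite gt_eqF.
Qed.

End Supports.

(** * Two weighted vertices outside the near-clique *)

Section OutsideVertices.
Variables (R : realFieldType) (I : finType).
Implicit Types (A B P T e f : {set I}) (E : {set {set I}}) (x : I -> R).

Lemma card_draws_mem P k u : u \in P ->
  (#|[set e in draws P k.+1 | u \in e]| <= 'C(#|P|.-1, k))%N.
Proof.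
move=> uP; have -> : #|P|.-1 = #|P :\ u| by rewrite (cardsD1 u P) uP.
rewrite -card_draws_set.
rewrite -(card_in_imset (f := fun e : {set I} => e :\ u)); last first.
  move=> e f; rewrite !inE => /andP[_ ue] /andP[_ uf] ef.
  by rewrite -(setD1K ue) ef setD1K.
apply/subset_leq_card/subsetP => f /imsetP[e]; rewrite inE => /andP[/drawsP[eP ek] ue] ->.
apply/drawsP; split; first by apply: setSD.
by move: ek; rewrite (cardsD1 u e) ue => -[].
Qed.

Lemma wt_le_expr x (mu : R) e : (forall i, 0 <= x i) -> (forall i, x i <= mu) ->
  wt x e <= mu ^+ #|e|.
Proof. by move=> x0 xmu; rewrite -prodr_const; apply: ler_prod => i _; rewrite x0 xmu. Qed.

(** At most [(r - 1)(r - 2) + 1] edges contain [u]. This is below [a^2 / 2] for [a = (3 r - 4) / 2],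
    a choice linear in [r] that avoids a square root in [link_le_card]. *)
Lemma max_weight_le P x E (r : R) u : r = #|P|%:R -> 5 <= r ->
  (forall e, e \in E -> #|e| = 3%N) -> in_simplex x ->
  3 * clique_lagrangian r <= link x u E -> u \in P ->
  #|E :\: draws P 3|%:R <= (r - 1) * (r - 2) / 2 + 1 ->
  x u <= 5 / (4 * r).
Proof.
move=> rP r5 E3 xS ge uP out; have [x0 x1] := xS.
have xu1 : x u <= 1.
  by rewrite -x1 (bigD1 u) //= lerDl; apply: sumr_ge0 => j _; exact: x0.
have a0 : 0 < (3 * r - 4) / 2 by lra.
have N : #|[set e in E | u \in e]|%:R <= ((3 * r - 4) / 2) ^+ 2 / 2 :> R.
  have : (#|[set e in E | u \in e]| <=
          #|E :\: draws P 3| + 'C(#|P|.-1, 2))%N.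
    apply: (leq_trans _ (leq_add (leqnn _) (card_draws_mem 2 uP))).
    apply: leq_trans (leq_card_setU _ _).1; apply/subset_leq_card/subsetP => e.
    by rewrite !in_setU !inE => /andP[eE ->]; rewrite eE !andbT orNb.
  rewrite -(ler_nat R) natrD bin2R.
  have -> : #|P|.-1%:R = r - 1 :> R.
    by rewrite rP (cardsD1 u P) uP /= -natr1; lra.
  by move=> h; apply: (le_trans h); nra.
have := link_le_card E3 xS a0 N; set L := link x u E in ge * => hL.
rewrite leNgt; apply/negP => mu.
have r0 : 0 < r by lra.
have h1 : 1 - x u < 1 - 5 / (4 * r) by lra.
have h2 : (1 - x u) ^+ 2 <= (1 - 5 / (4 * r)) ^+ 2.
  by rewrite ler_pXn2r ?nnegrE //; lra.
have h3 : 2 * ((3 * r - 4) / 2 + 1) * (3 * clique_lagrangian r) <=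
  (3 * r - 4) / 2 * (1 - 5 / (4 * r)) ^+ 2 by nra.
have : 2 * ((3 * r - 4) / 2 + 1) * (3 * clique_lagrangian r) * (32 * r ^+ 2) <=
  (3 * r - 4) / 2 * (1 - 5 / (4 * r)) ^+ 2 * (32 * r ^+ 2).
  by rewrite ler_pM2r // mulr_gt0 // exprn_gt0.
have -> : 2 * ((3 * r - 4) / 2 + 1) * (3 * clique_lagrangian r) * (32 * r ^+ 2) =
  16 * (3 * r - 2) * ((r - 1) * (r - 2)).
  by rewrite /clique_lagrangian; field; rewrite gt_eqF.
have -> : (3 * r - 4) / 2 * (1 - 5 / (4 * r)) ^+ 2 * (32 * r ^+ 2) =
  (3 * r - 4) * (4 * r - 5) ^+ 2.
  by field; rewrite gt_eqF.
(* The cubic terms cancel, and [8 r^2 - 43 r + 36 > 0] for [r >= 5]. *)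
nra.
Qed.

(** Edges through both vertices differ in their third vertex, so the sum runs over weights of
    distinct vertices. *)
Lemma link_pair_le_sum x E c c' : in_simplex x ->
  (forall e, e \in E -> #|e| = 3%N) -> c != c' ->
  \sum_(e in E | (c \in e) && (c' \in e)) wt x (e :\ c :\ c') <= 1.
Proof.
move=> [x0 x1] E3 cc'; pose L := [set e :\ c | e in [set e in E | c \in e]].
have L2 f : f \in L -> #|f| = 2%N.
  by move=> /(subsetP (link_sub_draws c E3))/drawsP[].
apply: le_trans (_ : link x c' L <= 1); last first.
  apply: (le_trans (link_le_espoly _ x0 L2)).
  rewrite espoly1 -x1 [leRHS](bigID (mem (~: [set c']))) /= lerDl.
  by apply: sumr_ge0 => i _; exact: x0.
rewrite /link [leRHS]big_mkcondr /L big_imset /=; last first.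
  move=> e f; rewrite !inE => /andP[_ ce] /andP[_ cf] ef.
  by rewrite -(setD1K ce) ef setD1K.
rewrite -[leRHS]big_mkcondr /= le_eqVlt; apply/orP; left; apply/eqP.
by apply: eq_bigl => e; rewrite !inE [c' == c]eq_sym cc' -andbA.
Qed.

(** Add the link conditions at [c] and [c']. An outside edge through one of them contributes at most
    [mu ^+ 2], with [mu] the largest weight; one through both exceeds this by at most its third
    weight times the positive part of [g - mu], where [g] is the weight of the two, and the third
    weights sum to at most 1. *)
Lemma outside_pair_absurd P x E (r : R) c c' : r = #|P|%:R -> 5 <= r ->
  (forall e, e \in E -> #|e| = 3%N) -> in_simplex x ->
  (forall i, 0 < x i -> 3 * wsum x E <= link x i E) ->
  clique_lagrangian r <= wsum x E ->
  (forall i j, i \notin P -> j \in P -> x i <= x j) ->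
  #|E :\: draws P 3|%:R <= (r - 1) * (r - 2) / 2 + 1 ->
  c \notin P -> c' \notin P -> c != c' -> 0 < x c -> 0 < x c' -> False.
Proof.
move=> rP r5 E3 xS xlink ge top out cP c'P cc' xc xc'; have [x0 x1] := xS.
have r0 : 0 < r by lra.
have /set0Pn[u0 u0P] : P != set0.
  by apply: contraTneq r5 => P0; rewrite rP P0 cards0 -ltNge ltr0n.
have [u uP umax] : exists2 u, u \in P & forall i, i \in P -> x i <= x u.
  by case: (arg_maxP x u0P) => u uP um; exists u.
have xmax i : x i <= x u.
  by case: (boolP (i \in P)) => [/umax //|iP]; apply: top.
have mu0 : 0 < x u by apply: lt_le_trans (xmax c).
have mule : x u <= 5 / (4 * r).
  apply: (max_weight_le rP r5 E3 xS) => //.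
  by apply: le_trans (xlink _ mu0); lra.
set mu := x u in xmax mu0 mule.
pose g := x c + x c'.
(* Every vertex of [P] weighs at least the mean [g / 2] of the two outside ones, so
   [r * g / 2 <= 1 - g]. *)
have gle : g * (r + 2) <= 2.
  have : \sum_(i in P) g / 2 <= 1 - g.
    have -> : 1 - g = \sum_(i | (i != c) && (i != c')) x i.
      by rewrite -x1 (bigD1 c) //= (bigD1 c') 1?eq_sym //= /g; lra.
    apply: le_trans (_ : \sum_(i in P) x i <= _).
      apply: ler_sum => i iP; have := top _ _ cP iP; have := top _ _ c'P iP.
      by rewrite /g; lra.
    rewrite [leRHS](bigID (mem P)) /= -[leLHS]addr0 lerD //.
      rewrite le_eqVlt; apply/orP; left; apply/eqP; apply: eq_bigl => i.
      case iP: (i \in P); rewrite ?andbF // andbT; symmetry; apply/andP.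
      by split; apply: contraTneq iP => ->.
    by apply: sumr_ge0 => i _; exact: x0.
  by rewrite sumr_const -[leLHS]mulr_natr -rP; lra.
pose m := Num.max 0 (g - mu).
have m0 : 0 <= m by rewrite le_max lexx.
have mg : g - mu <= m by rewrite le_max lexx orbT.
pose O := E :\: draws P 3.
have inO c1 e : c1 \notin P -> e \in E -> c1 \in e -> e \in O.
  move=> c1P eE c1e; rewrite !inE eE andbT negb_and; apply/orP; left.
  by apply/subsetPn; exists c1.
have linkO c1 : c1 \notin P -> link x c1 E = \sum_(e in O) (if c1 \in e then wt x (e :\ c1) else 0).
  move=> c1P; rewrite -big_mkcondr /link; apply: eq_bigl => e.
  apply/andP/andP => -[]; last by rewrite inE => /andP[_ ->] ->.
  by move=> eE c1e; split=> //; apply: inO c1e.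
have wtle c1 e : e \in O -> c1 \in e -> wt x (e :\ c1) <= mu ^+ 2.
  rewrite inE => /andP[_ eE] c1e; apply: (le_trans (wt_le_expr _ x0 xmax)).
  by have := E3 _ eE; rewrite (cardsD1 c1) c1e => /eqP; rewrite eqSS => /eqP ->.
have key : link x c E + link x c' E <= #|O|%:R * mu ^+ 2 + m.
  rewrite !linkO // -big_split /=.
  apply: le_trans (_ : \sum_(e in O) (mu ^+ 2 +
     (if (c \in e) && (c' \in e) then wt x (e :\ c :\ c') * m else 0)) <= _).
    apply: ler_sum => e eO; have mu2 : 0 <= mu ^+ 2 by rewrite sqr_ge0.
    case ce: (c \in e); case c'e: (c' \in e) => /=; rewrite ?addr0 ?add0r ?wtle //.
    have e3 : #|e| = 3%N by apply: E3; move: eO; rewrite inE => /andP[].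
    have c1 : c' \in e :\ c by rewrite !inE [c' == c]eq_sym cc'.
    have c2 : c \in e :\ c' by rewrite !inE cc'.
    have wle : wt x (e :\ c :\ c') <= mu ^+ 1.
      apply: (le_trans (wt_le_expr _ x0 xmax)).
      move: e3; rewrite (cardsD1 c) ce => /eqP; rewrite eqSS => /eqP.
      by rewrite (cardsD1 c') c1 => /eqP; rewrite eqSS => /eqP ->.
    have w0 := wt_ge0 (e :\ c :\ c') x0.
    rewrite (wt_D1 x c1) (wt_D1 x c2).
    have -> : e :\ c' :\ c = e :\ c :\ c' by rewrite setDDl setUC -setDDl.
    rewrite expr1 in wle; rewrite -mulrDl addrC -/g.
    have := ler_wpM2r w0 mg; have := ler_wpM2l (ltW mu0) wle; lra.
  rewrite big_split sumr_const /= -[X in X + _]mulr_natl lerD2l -big_mkcondr /= -mulr_suml.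
  rewrite -[leRHS]mul1r ler_wpM2r //.
  apply: le_trans (link_pair_le_sum xS E3 cc').
  rewrite le_eqVlt; apply/orP; left; apply/eqP; apply: eq_bigl => e.
  apply/andP/andP => -[]; first by rewrite inE => /andP[_ ->].
  by move=> eE /andP[ce c'e]; split; [apply: inO ce|rewrite ce].
have {key} : 6 * clique_lagrangian r <= ((r - 1) * (r - 2) / 2 + 1) * mu ^+ 2 + m.
  apply: le_trans (_ : link x c E + link x c' E <= _).
    by have := xlink _ xc; have := xlink _ xc'; lra.
  by apply: (le_trans key); rewrite lerD2r ler_wpM2r ?sqr_ge0.
rewrite leNgt => /negP; apply.
have -> : 6 * clique_lagrangian r = (r - 1) * (r - 2) / r ^+ 2.
  by rewrite /clique_lagrangian; field; rewrite gt_eqF.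
rewrite ltr_pdivlMr ?exprn_gt0 //.
set mr := mu * r; have mr0 : 0 < mr by apply: mulr_gt0.
have mr1 : mr <= 5 / 4.
  by move: mule; rewrite ler_pdivlMr ?mulr_gt0 // /mr; lra.
have mr2 : mr ^+ 2 <= 25 / 16 by nra.
rewrite /m; case: (lerP 0 (g - mu)) => gm; last first.
  have -> : (((r - 1) * (r - 2) / 2 + 1) * mu ^+ 2 + 0) * r ^+ 2 =
    ((r - 1) * (r - 2) / 2 + 1) * mr ^+ 2 by rewrite /mr; ring.
  have : 0 < (r - 1) * (r - 2) / 2 + 1 by nra.
  by move=> h; have := ler_wpM2l (ltW h) mr2; nra.
rewrite -(@ltr_pM2r _ (r + 2)); last lra.
set q := (r - 1) * (r - 2) / 2 + 1.
have qr : 0 <= q * (5 / 4) - r by rewrite /q; nra.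
have q0 : 0 <= q by lra.
have -> : (q * mu ^+ 2 + (g - mu)) * r ^+ 2 * (r + 2) =
  (q * mr ^+ 2 - r * mr) * (r + 2) + g * (r + 2) * r ^+ 2 by rewrite /mr; ring.
have h1 : g * (r + 2) * r ^+ 2 <= 2 * r ^+ 2 by rewrite ler_wpM2r ?sqr_ge0.
have h2 : q * mr ^+ 2 - r * mr <= 5 / 4 * (q * (5 / 4) - r).
  have h3 : mr ^+ 2 <= 5 / 4 * mr by nra.
  have := ler_wpM2l q0 h3; have := ler_wpM2r qr mr1; lra.
have r20 : 0 <= r + 2 by lra.
have h4 := ler_wpM2r r20 h2.
apply: le_lt_trans (lerD h4 h1) _; rewrite /q.
(* Expanding the difference at [r = 5] leaves only positive coefficients. *)
have -> : 5 / 4 * (((r - 1) * (r - 2) / 2 + 1) * (5 / 4) - r) * (r + 2) + 2 * r ^+ 2 =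
  (r - 1) * (r - 2) * (r + 2) - ((r - 5) * (7 * (r - 5) ^+ 2 + 74 * (r - 5) + 217) + 38) / 32 by field.
have s0 : 0 <= r - 5 by lra.
by rewrite gtrBl divr_gt0 // ltr_wpDl // mulr_ge0 // !addr_ge0 // mulr_ge0 // sqr_ge0.
Qed.

End OutsideVertices.

(** * Degree sums of the graph of missing pairs *)

Definition deg (R : realFieldType) (I : finType) (N : {set {set I}}) (i : I) : R :=
  #|[set f in N | i \in f]|%:R.

Section Degrees.
Variables (R : realFieldType) (I : finType).
Implicit Types (A B P T e f : {set I}) (E N : {set {set I}}) (x : I -> R).

Lemma degE N i : deg R N i = \sum_(f in N) (i \in f)%:R.
Proof.
rewrite /deg -sum1_card natr_sum big_mkcond [RHS]big_mkcond /=.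
by apply: eq_bigr => f _; rewrite inE; case: (f \in N); case: (i \in f).
Qed.

Lemma sum_deg N A (g : I -> R) :
  \sum_(i in A) deg R N i * g i = \sum_(f in N) \sum_(i in f :&: A) g i.
Proof.
under eq_bigr do rewrite degE mulr_suml.
rewrite exchange_big /=; apply: eq_bigr => f _.
rewrite big_mkcond [RHS]big_mkcond /=; apply: eq_bigr => i _; rewrite inE andbC.
by case: (i \in A); case: (i \in f) => //=; rewrite ?mul1r ?mul0r.
Qed.

Lemma sum_deg1 N A : \sum_(i in A) deg R N i = \sum_(f in N) #|f :&: A|%:R.
Proof.
under eq_bigr do rewrite -[deg _ _ _]mulr1.
by rewrite sum_deg; apply: eq_bigr => f _; rewrite sumr_const.
Qed.

Lemma card_pairI f A : #|f| = 2%N -> (#|f :&: A| <= 1 + (f \subset A))%N.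
Proof.
move=> f2; case: (boolP (f \subset A)) => [_|fA].
  by apply: leq_trans (subset_leq_card (subsetIl _ _)) _; rewrite f2.
have : f :&: A \proper f.
  rewrite properEneq subsetIl andbT.
  by apply: contra fA => /eqP <-; exact: subsetIr.
by move/proper_card; rewrite f2 ltnS.
Qed.

Lemma sum_deg_pairs N A : (forall f, f \in N -> #|f| = 2%N) ->
  \sum_(i in A) deg R N i <= #|N|%:R + #|N :&: draws A 2|%:R.
Proof.
move=> N2; rewrite sum_deg1.
have -> : #|N|%:R + #|N :&: draws A 2|%:R =
  \sum_(f in N) (1 + (f \subset A))%:R :> R.
  rewrite (eq_bigr (fun f => 1 + (f \subset A)%:R)); last by move=> f _; rewrite natrD.
  rewrite big_split /= sumr_const; congr (_ + _).
  rewrite -sum1_card natr_sum big_mkcond [RHS]big_mkcond /=.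
  apply: eq_bigr => f _; rewrite !inE; case fN: (f \in N) => //=.
  by rewrite (N2 _ fN) eqxx andbT; case: (f \subset A).
by apply: ler_sum => f fN; rewrite ler_nat card_pairI ?N2.
Qed.

(** Distinct pairs share at most one vertex: [f] contributes 2, every other pair at most 1. *)
Lemma sum_deg_edge N f : (forall f, f \in N -> #|f| = 2%N) -> f \in N ->
  \sum_(i in f) deg R N i <= #|N|%:R + 1.
Proof.
move=> N2 fN; apply: (le_trans (sum_deg_pairs f N2)); rewrite lerD2l.
rewrite -[leRHS]/(1%:R) ler_nat -(cards1 f); apply/subset_leq_card/subsetP => g.
rewrite !inE => /andP[gN /andP[gf _]].
by rewrite eqEcard gf (N2 _ gN) (N2 _ fN).
Qed.

Lemma sum_deg_vertices N P : N \subset draws P 2 ->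
  \sum_(i in P) deg R N i = 2 * #|N|%:R.
Proof.
move=> /subsetP NP; rewrite sum_deg1 mulr_natr -sumr_const.
by apply: eq_bigr => f /NP/drawsP[/setIidPl -> ->].
Qed.

Lemma sum_deg_sqr N P : N \subset draws P 2 ->
  \sum_(i in P) deg R N i ^+ 2 = \sum_(f in N) \sum_(i in f) deg R N i.
Proof.
move=> /subsetP NP; under eq_bigr do rewrite expr2.
by rewrite sum_deg; apply: eq_bigr => f /NP/drawsP[/setIidPl ->].
Qed.

(** By double counting, the squares sum to the total over all pairs of the degrees of their two
    ends, and [sum_deg_edge] bounds each term. *)
Lemma sum_deg_sqr_le N P : N \subset draws P 2 ->
  \sum_(i in P) deg R N i ^+ 2 <= #|N|%:R * (#|N|%:R + 1).
Proof.
move=> NP; rewrite (sum_deg_sqr NP) mulr_natl -sumr_const.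
apply: ler_sum => f fN; apply: sum_deg_edge => // g /(subsetP NP).
by case/drawsP.
Qed.

(** The three pairs inside [e] count each degree on [e] twice; each of the other [r - 5] pairs
    contributes at most [r - 1]. *)
Lemma sum_deg_sqr_triangle N P e (r : R) : N \subset draws P 2 -> #|e| = 3%N ->
  draws e 2 \subset N -> #|N|%:R = r - 2 ->
  \sum_(i in P) deg R N i ^+ 2 <= 2 * (\sum_(i in e) deg R N i) + (r - 5) * (r - 1).
Proof.
move=> NP e3 eN Nr; have N2 f : f \in N -> #|f| = 2%N.
  by move/(subsetP NP)/drawsP=> [].
rewrite (sum_deg_sqr NP) (big_setID (draws e 2)) /= (setIidPr eN) lerD //.
  rewrite [leLHS](_ : _ = \sum_(i in e) deg R (draws e 2) i * deg R N i).
    rewrite mulr_sumr; apply: ler_sum => i ie; rewrite ler_wpM2r ?ler0n //.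
    by rewrite /deg ler_nat; apply: leq_trans (card_draws_mem 1 ie) _; rewrite e3.
  by rewrite sum_deg; apply: eq_bigr => f /drawsP[/setIidPl ->].
have -> : (r - 5) * (r - 1) = \sum_(f in N :\: draws e 2) (r - 1).
  rewrite sumr_const -[RHS]mulr_natl; congr (_ * _).
  by rewrite cardsD (setIidPr eN) natrB ?subset_leq_card // Nr card_draws_set e3 -[(binomial _ _)%:R]/(3%:R); lra.
apply: ler_sum => f; rewrite inE => /andP[_ fN].
by apply: (le_trans (sum_deg_edge N2 fN)); rewrite Nr; lra.
Qed.

(** Each product is replaced by its tangent at [(h, h)]; the dropped term [(x a - h)(x b - h)] is
    nonnegative. *)
Lemma wsum_pairs_ge x N P (h : R) : N \subset draws P 2 ->
  (forall i, i \in P -> h <= x i) ->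
  #|N|%:R * h ^+ 2 + h * (\sum_(i in P) deg R N i * (x i - h)) <= wsum x N.
Proof.
move=> NP hx; rewrite sum_deg mulr_sumr mulr_natl -sumr_const -big_split /=.
apply: ler_sum => f /(subsetP NP)/drawsP[fP /eqP/cards2P[a [b [ab fE]]]].
have := fP; rewrite fE subUset !sub1set => /andP[/hx ha /hx hb].
rewrite (setIidPl _) -?fE // /wt !fE !big_setU1 ?big_set1 /=; try by rewrite inE.
have : 0 <= (x a - h) * (x b - h) by rewrite mulr_ge0 ?subr_ge0.
lra.
Qed.

Lemma exists_subset_card E k : (k <= #|E|)%N -> exists2 N : {set {set I}}, N \subset E & #|N| = k.
Proof.
move=> kE; exists [set f in take k (enum E)].
  by apply/subsetP => f; rewrite inE => /mem_take; rewrite mem_enum.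
rewrite cardsE (card_uniqP _) ?take_uniq ?enum_uniq //.
by rewrite size_takel // -cardE.
Qed.

(** All sets minus the missing ones, sorted by membership of [v]. With all weights equal to 1 the
    identity counts edges. *)
Lemma wsum_vertexU1 x E P v k : v \notin P ->
  wsum x (E :&: draws (v |: P) k.+1) =
  espoly x k.+1 P + x v * espoly x k P - wsum x (draws P k.+1 :\: E)
  - x v * wsum x [set f in draws P k | v |: f \notin E].
Proof.
move=> vP.
have missing (F : {set I} -> R) (Q : pred {set I}) A j :
    \sum_(e in draws A j) (if Q e then F e else 0) =
    \sum_(e in draws A j) F e - \sum_(e in draws A j | ~~ Q e) F e.
  rewrite [X in _ - X]big_mkcondr -sumrB; apply: eq_bigr => e _.
  by case: (Q e); rewrite /= ?subr0 ?subrr.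
have -> : wsum x (E :&: draws (v |: P) k.+1) =
  \sum_(e in draws (v |: P) k.+1) (if e \in E then wt x e else 0).
  by rewrite -big_mkcondr; apply: eq_bigl => e; rewrite inE andbC.
rewrite (sum_drawsU1 _ _ vP) (missing _ (fun e => e \in E)) (missing _ (fun f => v |: f \in E)).
have -> : \sum_(f in draws P k) wt x (v |: f) = x v * espoly x k P.
  rewrite mulr_sumr; apply: eq_bigr => f /drawsP[fP _]; rewrite wt_U1 //.
  by apply: contra vP => /(subsetP fP).
have -> : \sum_(f in draws P k | v |: f \notin E) wt x (v |: f) =
    x v * wsum x [set f in draws P k | v |: f \notin E].
  rewrite mulr_sumr; apply: eq_big => f; first by rewrite [RHS]in_set.
  case/andP=> /drawsP[fP _] _; rewrite wt_U1 //.
  by apply: contra vP => /(subsetP fP).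
rewrite /espoly /wsum.
rewrite [X in _ - X + _](eq_bigl (fun e => e \in draws P k.+1 :\: E)); first by lra.
by move=> e; rewrite in_setD andbC.
Qed.

Lemma wsum1 E : wsum (fun=> 1 : R) E = #|E|%:R.
Proof. by rewrite /wsum -sumr_const; apply: eq_bigr => e _; rewrite /wt big1. Qed.

End Degrees.

(** * A single weighted vertex outside the near-clique *)

Section OneOutsideVertex.
Variables (R : realFieldType) (I : finType).
Implicit Types (A B P T e f : {set I}) (E N : {set {set I}}) (x : I -> R).

(** As for the weights in [small_support], except that [v] is kept out of Cauchy-Schwarz and its
    weight enters by completing a square. *)
Lemma weight_le_one_outside x E P v (r : R) i : r = #|P|%:R -> 5 <= r ->
  (forall e, e \in E -> #|e| = 3%N) -> in_simplex x ->
  (forall j, j \notin v |: P -> x j = 0) -> v \notin P ->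
  3 * clique_lagrangian r <= link x i E -> i \in P ->
  x i <= 1 / r + x v / (r - 2).
Proof.
move=> rP r5 E3 xS xT vP ge iP; have [x0 x1] := xS.
have viP : v \notin P :\ i by rewrite !inE negb_and vP orbT.
have sumT (g : I -> R) : (forall j, j \notin v |: P -> g j = 0) ->
    \sum_(j in ~: [set i]) g j = g v + \sum_(j in P :\ i) g j.
  move=> gT; rewrite -big_setU1 //= (big_setID (v |: P)) /= [X in _ + X]big1 ?addr0.
    apply: eq_bigl => j; rewrite !inE; case: (eqVneq j v) => [->|] //=.
    by rewrite andbT; apply: contraNneq vP => ->.
  by move=> j; rewrite inE => /andP[/gT].
have := link_le i E3 xS; have := sum_setC1 i xS; rewrite !sumT //; last first.
  by move=> j /xT ->; rewrite expr0n.
set u := \sum_(j in _) x j; set Q := \sum_(j in _) _ => us hL.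
have u0 : 0 <= u by apply: sumr_ge0 => j _; exact: x0.
have z0 := x0 v; set z := x v in us hL z0 *.
have uQ : u ^+ 2 <= (r - 1) * Q.
  apply: sqr_sum_le; first by lra.
  by rewrite rP (cardsD1 i P) iP natrD mulr1n; lra.
have r0 : r != 0 by lra.
have r1 : r - 1 != 0 by lra.
have r2 : r - 2 != 0 by lra.
have h1 : 6 * clique_lagrangian r <= u ^+ 2 + 2 * u * z - Q.
  by move: hL; rewrite -us; set L := link x i E in ge *; lra.
have h2 : 6 * clique_lagrangian r * (r - 1) <= u ^+ 2 * (r - 2) + 2 * u * z * (r - 1).
  have r10 : 0 <= r - 1 by lra.
  have := ler_wpM2r r10 h1; lra.
have h3 : ((r - 1) / r) ^+ 2 <= (u + z * (r - 1) / (r - 2)) ^+ 2.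
  have h4 : 6 * clique_lagrangian r * (r - 1) / (r - 2) <=
      (u ^+ 2 * (r - 2) + 2 * u * z * (r - 1)) / (r - 2).
    by rewrite ler_wpM2r // invr_ge0; lra.
  have e1 : 6 * clique_lagrangian r * (r - 1) / (r - 2) = ((r - 1) / r) ^+ 2.
    by rewrite /clique_lagrangian; field; rewrite r0.
  have e2 : (u ^+ 2 * (r - 2) + 2 * u * z * (r - 1)) / (r - 2) =
     (u + z * (r - 1) / (r - 2)) ^+ 2 - (z * (r - 1) / (r - 2)) ^+ 2 by field.
  have := sqr_ge0 (z * (r - 1) / (r - 2)); move: h4; rewrite e1 e2; lra.
have h4 : (r - 1) / r <= u + z * (r - 1) / (r - 2).
  rewrite -(@ler_pXn2r _ 2) // nnegrE; first by rewrite divr_ge0; lra.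
  by rewrite addr_ge0 // divr_ge0 ?mulr_ge0 //; lra.
have e1 : (r - 1) / r = 1 - 1 / r by field.
have e2 : z * (r - 1) / (r - 2) = z + z / (r - 2) by field.
by move: h4; rewrite e1 e2; lra.
Qed.

(** Expanded at [h], the product is at least [h] times the bracket, and [z <= h]. The factor [2 / 3]
    divides the degree sum 2 of a pair among three vertices. *)
Lemma triangle_loss x e (h z : R) : #|e| = 3%N -> 0 <= z -> z <= h ->
  (forall i, i \in e -> h <= x i) ->
  z * (h ^+ 2 + 2 / 3 * h * (\sum_(i in e) (x i - h))) <= wt x e.
Proof.
move=> e3 z0 zh hx.
have /set0Pn[a ae] : e != set0 by rewrite -cards_eq0 e3.
have : #|e :\ a| == 2%N by move/eqP: e3; rewrite (cardsD1 a) ae eqSS.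
case/cards2P=> b [c [bc eE]].
have : b \in e :\ a by rewrite eE !inE eqxx.
rewrite in_setD1 => /andP[_ be].
have : c \in e :\ a by rewrite eE !inE eqxx orbT.
rewrite in_setD1 => /andP[_ ce].
rewrite (wt_D1 x ae) (big_setD1 a ae) /= eE big_setU1 ?big_set1 ?inE //=.
rewrite /wt big_setU1 ?big_set1 ?inE //=.
have := hx _ ae; have := hx _ be; have := hx _ ce.
set ta := x a; set tb := x b; set tc := x c => hc hb ha.
have h0 : 0 <= h by lra.
pose a' := ta - h; pose b' := tb - h; pose c' := tc - h.
have a0 : 0 <= a' by rewrite subr_ge0.
have b0 : 0 <= b' by rewrite subr_ge0.
have c0 : 0 <= c' by rewrite subr_ge0.
have -> : ta * (tb * tc) = h ^+ 3 + h ^+ 2 * (a' + b' + c') +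
  h * (a' * b' + b' * c' + a' * c') + a' * (b' * c') by rewrite /a' /b' /c'; ring.
rewrite -/a' -/b' -/c'.
have h1 : 0 <= h * (a' * b' + b' * c' + a' * c') by rewrite mulr_ge0 ?addr_ge0 ?mulr_ge0.
have h2 : 0 <= a' * (b' * c') by rewrite !mulr_ge0.
have h3 : 0 <= h ^+ 2 + 2 / 3 * h * (a' + (b' + c')).
  have := mulr_ge0 h0 a0; have := mulr_ge0 h0 b0; have := mulr_ge0 h0 c0.
  by have := sqr_ge0 h; lra.
have h4 := ler_wpM2r h3 zh.
have h5 : 0 <= h ^+ 2 * (a' + b' + c').
  by apply: mulr_ge0; [exact: sqr_ge0|lra].
have h6 : z * (h ^+ 2 + 2 / 3 * h * (a' + (b' + c'))) <=
  h * (h ^+ 2 + 2 / 3 * h * (a' + (b' + c'))) by [].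
lra.
Qed.

(** The one configuration with [sum d_i^2 > p (p - 1)], excluded directly. *)
Lemma missing_tetrahedron x E P e v : #|P| = 5%N -> e \subset P -> #|e| = 3%N ->
  v \notin P -> in_simplex x -> (forall j, j \notin v |: P -> x j = 0) ->
  (forall f, f \in E -> #|f| = 3%N) -> E :&: draws (v |: e) 3 = set0 ->
  wsum x E < clique_lagrangian 5.
Proof.
move=> P5 eP e3 vP [x0 x1] xT E3 Ee.
have : #|P :\: e| == 2%N by rewrite cardsD (setIidPr eP) P5 e3.
case/cards2P=> a [b [ab PE]].
set A := v |: e.
have aPe : a \in P :\: e by rewrite PE !inE eqxx.
have bPe : b \in P :\: e by rewrite PE !inE eqxx orbT.
have notA i : i \in P :\: e -> i \notin A.
  rewrite !inE => /andP[/negbTE ie iP]; rewrite ie orbF.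
  by apply: contraNneq vP => <-.
have bA := notA _ bPe; have aA := notA _ aPe.
have abA : a \notin b |: A by rewrite in_setU1 negb_or ab.
have TE : v |: P = a |: (b |: A).
  by rewrite /A -(setID P e) (setIidPr eP) PE; apply/setP => i; rewrite !inE; do !bool_congr.
have xs : x a + (x b + \sum_(i in A) x i) = 1.
  rewrite -!big_setU1 //= -TE -x1 [RHS](bigID (mem (v |: P))) /= [X in _ + X]big1 ?addr0 //.
have : wsum x E <= espoly x 3 (v |: P) - espoly x 3 A.
  rewrite (wsum_support xT E3) /espoly.
  have AT : draws A 3 \subset draws (v |: P) 3 by apply/drawsS/setUS.
  rewrite [X in _ <= X - _](wsumID x _ (draws A 3)) (setIidPr AT) addrAC subrr add0r.
  apply: wsum_le => //; apply/subsetP => f /setIP[fE fT]; rewrite inE fT andbT.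
  by apply/negP => fA; have /setP/(_ f) := Ee; rewrite in_setI fE fA inE.
rewrite TE (espolyU1 _ _ abA) !(espolyU1 _ _ bA) espoly1 [espoly x 2 A]espoly2.
have A4 : #|A| = 4%N.
  by rewrite cardsU1 e3; case: (boolP (v \in e)) => // /(subsetP eP); rewrite (negbTE vP).
have := @sqr_sum_le _ _ x A 4 (ltr0n _ 4); rewrite A4 lexx => /(_ isT).
have := x0 a; have := x0 b; have : 0 <= \sum_(i in A) x i by apply: sumr_ge0 => i _; exact: x0.
move: xs; set S := \sum_(i in A) x i; set Q := \sum_(i in A) _ => xs S0 b0 a0 SQ le.
apply: (le_lt_trans le).
have s0 : 0 <= x a + x b by rewrite addr_ge0.
have h1 : (S ^+ 2 - Q) / 2 <= 3 / 8 * S ^+ 2 by lra.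
have h2 := ler_wpM2l s0 h1.
have h3 : x a * x b <= (x a + x b) ^+ 2 / 4 by have := sqr_ge0 (x a - x b); lra.
have h4 := ler_wpM2r S0 h3.
have sE : x a + x b = 1 - S by lra.
set e3A := espoly x 3 A.
have -> : e3A + x b * ((S ^+ 2 - Q) / 2) + x a * ((S ^+ 2 - Q) / 2 + x b * S) - e3A =
  (x a + x b) * ((S ^+ 2 - Q) / 2) + x a * x b * S by field.
rewrite sE in h2 h4 *.
(* [11 / 20] is close to the maximiser of [S (1 - S)(2 + S) / 8], whose maximum lies just below
   [clique_lagrangian 5 = 2 / 25]. *)
have h5 : 0 <= (S - 11 / 20) ^+ 2 * (S + 21 / 10) by rewrite mulr_ge0 ?sqr_ge0 //; lra.
rewrite /clique_lagrangian.
lra.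
Qed.

End OneOutsideVertex.

Section OneOutsideVertexBound.
Variables (R : realFieldType) (I : finType).
Implicit Types (A B P T e f : {set I}) (E N : {set {set I}}) (x : I -> R).

Lemma one_outside_vertex x E P v (r : R) : r = #|P|%:R -> (5 <= #|P|)%N ->
  (forall e, e \in E -> #|e| = 3%N) -> in_simplex x ->
  (forall i, 0 < x i -> 3 * wsum x E <= link x i E) ->
  clique_lagrangian r <= wsum x E ->
  (forall j, j \notin v |: P -> x j = 0) -> v \notin P -> 0 < x v ->
  (forall j, j \in P -> x v <= x j) ->
  (#|E| <= 'C(#|P|, 3) + 'C(#|P|.-1, 2))%N -> (#|draws P 3 :\: E| <= 1)%N ->
  wsum x E <= clique_lagrangian r /\
  (clique_lagrangian r <= wsum x E ->
   exists2 w, w \in P &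
     (forall i, i \in P -> i != w -> x i = 1 / r) /\ x w + x v = 1 / r).
Proof.
move=> rP P5 E3 xS xlink ge xT vP z0 top cardE D1; have [x0 x1] := xS.
have r5 : 5 <= r by rewrite rP (ler_nat R 5).
have /set0Pn[u0 u0P] : P != set0 by rewrite -card_gt0; apply: leq_trans P5.
have [w wP wmin] : exists2 w, w \in P & forall i, i \in P -> x w <= x i.
  by case: (arg_minP x u0P) => w wP wm; exists w.
have zh : x v <= x w by apply: top.
have h0 : 0 < x w by apply: lt_le_trans zh.
pose D := draws P 3 :\: E; pose M := [set f in draws P 2 | v |: f \notin E].
have MP : M \subset draws P 2 by apply/subsetP => f; rewrite in_set => /andP[].
have xub i : i \in P -> x i <= 1 / r + x v / (r - 2).
  move=> iP; have xi : 0 < x i by apply: lt_le_trans (top _ iP).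
  apply: (weight_le_one_outside rP r5 E3 xS xT vP _ iP).
  by apply: le_trans (xlink _ xi); lra.
have xsP : \sum_(i in P) x i = 1 - x v.
  suff : x v + \sum_(i in P) x i = 1 by lra.
  by rewrite -big_setU1 //= -x1 [RHS](bigID (mem (v |: P))) /= [X in _ + X]big1 ?addr0.
have wE : wsum x E = espoly x 3 P + x v * espoly x 2 P - wsum x D - x v * wsum x M.
  by rewrite (wsum_support xT E3) (wsum_vertexU1 _ _ _ vP).
(* Of the [C(p,3) + C(p,2)] triples on [v |: P], the edge bound admits [C(p,3) + C(p-1,2)]. *)
have count : (#|P|.-1 <= #|D| + #|M|)%N.
  have := wsum_vertexU1 (fun=> 1 : R) E 2 vP.
  rewrite /espoly !wsum1 !card_draws_set mul1r mul1r -/D -/M => cE.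
  have h : #|E :&: draws (v |: P) 3|%:R <= ('C(#|P|, 3) + 'C(#|P|.-1, 2))%N%:R :> R.
    by rewrite ler_nat; apply: leq_trans cardE; rewrite subset_leq_card ?subsetIl.
  have pr : #|P|.-1%:R = r - 1 :> R.
    by rewrite rP (cardsD1 u0 P) u0P /= -natr1; lra.
  rewrite -(ler_nat R) natrD pr; move: h; rewrite cE natrD !bin2R pr -rP; lra.
have bound (d : I -> R) : \sum_(i in P) d i = 2 * (r - 1) ->
    \sum_(i in P) d i ^+ 2 <= r * (r - 1) ->
    x v * x w * ((r - 1) * x w + \sum_(i in P) d i * (x i - x w)) <=
      wsum x D + x v * wsum x M ->
  wsum x E <= clique_lagrangian r /\
  (clique_lagrangian r <= wsum x E ->
   exists2 w, w \in P &
     (forall i, i \in P -> i != w -> x i = 1 / r) /\ x w + x v = 1 / r).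
  move=> ds dq loss.
  have [|A1 A2] := clique_perturbation_bound (lam := wsum x E) rP r5 wP z0 (ltW h0) wmin xub xsP ds dq.
    by rewrite wE; lra.
  by split=> // /A2 A3; exists w.
have wD0 : 0 <= wsum x D by apply: sumr_ge0 => e _; apply: wt_ge0.
have cardP1 : #|P|.-1%:R = r - 1 :> R.
  by rewrite rP (cardsD1 u0 P) u0P /= -natr1; lra.
(* With at least [p - 1] missing pairs, exactly [p - 1] are kept and their degrees serve as [d].
   Otherwise one triple [e] of [P] and [p - 2] pairs are missing. *)
have [Mbig|Msmall] := leqP #|P|.-1 #|M|.
  have [N NM cN] := exists_subset_card Mbig.
  have NP := subset_trans NM MP.
  have cNr : #|N|%:R = r - 1 :> R by rewrite cN.
  apply: (bound (deg R N)).
  - by rewrite (sum_deg_vertices _ NP) cNr.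
  - by apply: (le_trans (sum_deg_sqr_le _ NP)); rewrite cNr; lra.
  - have h1 := wsum_pairs_ge NP wmin.
    have h2 := wsum_le x0 NM; rewrite cNr in h1.
    have := ler_wpM2l (ltW z0) (le_trans h1 h2).
    by lra.
have cD : #|D| = 1%N.
  by apply/eqP; rewrite eqn_leq D1 lt0n; apply: contraTneq count => ->; rewrite -ltnNge.
have cMr : #|M|%:R = r - 2 :> R.
  have cM : #|P|.-1 = #|M|.+1.
    by apply/eqP; rewrite eqn_leq Msmall andbT; move: count; rewrite cD add1n.
  by move: cardP1; rewrite cM -natr1; lra.
have /cards1P[e De] : #|D| == 1%N by rewrite cD.
have : e \in D by rewrite De inE.
rewrite in_setD => /andP[eE /drawsP[eP e3]].
have wDe : wsum x D = wt x e by rewrite De /wsum big_set1.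
have M2 f : f \in M -> #|f| = 2%N by move/(subsetP MP)/drawsP => [].
pose S := \sum_(i in e) deg R M i.
(* The missing triple [e] weighs at least [x v] times each of its pairs: it
   stands for one more missing pair, spread evenly over the three. *)
pose d i := deg R M i + 2 / 3 * (i \in e)%:R.
have sume (g : I -> R) : \sum_(i in P) g i * (i \in e)%:R = \sum_(i in e) g i.
  rewrite big_mkcond [RHS]big_mkcond /=; apply: eq_bigr => i _.
  case ie: (i \in e); first by rewrite (subsetP eP _ ie) mulr1.
  by rewrite mulr0 if_same.
have deg_sum : \sum_(i in P) d i = 2 * (r - 1).
  rewrite big_split /= -mulr_sumr (sum_deg_vertices _ MP) cMr.
  have -> : \sum_(i in P) (i \in e)%:R = 3 :> R.
    by under eq_bigr do rewrite -[_%:R]mul1r; rewrite sume sumr_const e3.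
  by lra.
have deg_sqr : \sum_(i in P) d i ^+ 2 =
    \sum_(i in P) deg R M i ^+ 2 + 4 / 3 * S + 4 / 3.
  have e49 : \sum_(i in P) 4 / 9 * (i \in e)%:R = 4 / 3 :> R.
    by rewrite sume sumr_const e3 -mulr_natr; lra.
  rewrite /S -sume mulr_sumr -[X in _ = _ + X]e49 -!big_split /=.
  apply: eq_bigr => i _; rewrite /d.
  by case: (i \in e); rewrite ?mulr1n ?mulr0n; field.
have loss : x v * x w * ((r - 1) * x w + \sum_(i in P) d i * (x i - x w)) <=
    wsum x D + x v * wsum x M.
  have -> : \sum_(i in P) d i * (x i - x w) =
      \sum_(i in P) deg R M i * (x i - x w) + 2 / 3 * \sum_(i in e) (x i - x w).
    rewrite -sume mulr_sumr -big_split /=; apply: eq_bigr => i _.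
    by rewrite /d; ring.
  have := ler_wpM2l (ltW z0) (wsum_pairs_ge MP wmin); rewrite cMr.
  have := triangle_loss (x := x) e3 (ltW z0) zh (fun i ie => wmin i (subsetP eP _ ie)).
  by rewrite wDe; lra.
have degM := sum_deg_sqr_le R MP; rewrite cMr in degM.
have Sle := sum_deg_pairs R e M2; rewrite -/S cMr in Sle.
(* If some pair of [e] forms an edge with [v], then [S <= r] and the general bound on squares
   suffices from [r = 5] on. *)
have [eM|neM] := boolP (draws e 2 \subset M); last first.
  apply: (bound d) => //; rewrite deg_sqr.
  have : #|M :&: draws e 2|%:R <= 2 :> R.
    rewrite (ler_nat R _ 2) -ltnS.
    have -> : 3%N = #|draws e 2| by rewrite card_draws_set e3.
    apply: proper_card; rewrite properEneq subsetIr andbT.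
    by apply: contra neM => /eqP <-; apply: subsetIl.
  by lra.
have tri := sum_deg_sqr_triangle MP e3 eM cMr; rewrite -/S in tri.
have S3 : S <= r + 1.
  have : #|M :&: draws e 2|%:R <= 3 :> R.
    rewrite (ler_nat R _ 3).
    have -> : 3%N = #|draws e 2| by rewrite card_draws_set e3.
    by apply: subset_leq_card; apply: subsetIr.
  by lra.
(* With all pairs of [e] missing, the bound on squares is available for [r >= 6]. For [p = 5], the
   set [v |: e] spans no edge, and [missing_tetrahedron] applies. *)
have [P6|P5'] := ltnP 5 #|P|.
  apply: (bound d) => //; rewrite deg_sqr.
  have r6 : 6 <= r by rewrite rP (ler_nat R 6).
  by nra.
have {P5'}P5 : #|P| = 5%N by apply/eqP; rewrite eqn_leq P5' P5.
exfalso; have : wsum x E < clique_lagrangian r.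
  rewrite rP P5; apply: (missing_tetrahedron P5 eP e3 vP) => //.
  apply/setP => f; rewrite in_set0 in_setI; apply/negP => /andP[fE /drawsP[fve f3]].
  case: (boolP (v \in f)) => vf; last first.
    have fe : f \subset e.
      by apply/subsetP => i fi; have := subsetP fve i fi; rewrite in_setU1;
        case: eqP => // iv; rewrite -iv fi in vf.
    have fe' : f = e by apply/eqP; rewrite eqEcard fe e3 f3.
    by move: eE; rewrite -fe' fE.
  have : f :\ v \in M.
    apply: (subsetP eM); apply/drawsP; split; first by rewrite subDset.
    by move/eqP: f3; rewrite (cardsD1 v) vf eqSS => /eqP.
  by rewrite in_set => /andP[_]; rewrite setD1K // fE.
by rewrite ltNge ge.
Qed.

End OneOutsideVertexBound.

(** * Compression towards heavier vertices *)

Definition near_clique (I : finType) p (E : {set {set I}}) (P : {set I}) : bool :=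
  [&& E \subset draws setT 3, (#|E| <= 'C(p, 3) + 'C(p.-1, 2))%N, #|P| == p
    & (#|draws P 3 :\: E| <= 1)%N].

(** The shift of extremal set theory, replacing [j] by [i]. An edge whose image is already present
    stays put, which keeps the map injective on [E]. *)
Definition compress_edge (I : finType) (i j : I) (E : {set {set I}}) (e : {set I}) :=
  if [&& j \in e, i \notin e & tperm i j @: e \notin E] then tperm i j @: e else e.

Definition compress (I : finType) (i j : I) (E : {set {set I}}) :=
  compress_edge i j E @: E.

Section Compression.
Variables (R : realFieldType) (I : finType).
Implicit Types (A B P T e f : {set I}) (E N : {set {set I}}) (x : I -> R).

Lemma tperm_imsetK (i j : I) e : tperm i j @: (tperm i j @: e) = e.
Proof.
by rewrite -imset_comp (eq_imset (g := id)) ?imset_id // => k /=; rewrite tpermK.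
Qed.

Lemma tperm_imset_id (i j : I) e : i \notin e -> j \notin e -> tperm i j @: e = e.
Proof.
move=> ie je; rewrite -[RHS]imset_id; apply: eq_in_imset => k ke.
by rewrite tpermD //; apply: contraTneq ke => <-.
Qed.

Lemma mem_tperm_imset (i j k : I) e : (k \in tperm i j @: e) = (tperm i j k \in e).
Proof. by rewrite -[k in LHS](tpermK i j) mem_imset //; apply: perm_inj. Qed.

Lemma compress_edge_inj i j E : {in E &, injective (compress_edge i j E)}.
Proof.
move=> e f eE fE; rewrite /compress_edge.
case: ifP => [/and3P[_ _ eN]|_]; case: ifP => [/and3P[_ _ fN]|_] //.
- by apply: imset_inj; apply: perm_inj.
- by move=> ef; rewrite ef fE in eN.
- by move=> ef; rewrite -ef eE in fN.
Qed.

Lemma card_compress i j E : #|compress i j E| = #|E|.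
Proof. exact/card_in_imset/compress_edge_inj. Qed.

Lemma compress_uniform i j E k : E \subset draws setT k ->
  compress i j E \subset draws setT k.
Proof.
move=> /subsetP Ek; apply/subsetP => f /imsetP[e /Ek /drawsP[_ ek] ->].
apply/drawsP; split; first exact: subsetT.
by rewrite /compress_edge; case: ifP; rewrite ?card_imset //; apply: perm_inj.
Qed.

Lemma wsum_compress x i j E : (forall k, 0 <= x k) -> x j <= x i ->
  wsum x E <= wsum x (compress i j E).
Proof.
move=> x0 xji; rewrite /wsum big_imset /=; last exact: compress_edge_inj.
apply: ler_sum => e eE; rewrite /compress_edge; case: ifP => // /and3P[je ie _].
rewrite /wt big_imset /=; last by move=> ? ? _ _; apply: perm_inj.
apply: ler_prod => k ke; rewrite x0 /=.
case: (eqVneq k j) => [->|kj]; first by rewrite tpermR.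
rewrite tpermD //; last by rewrite eq_sym.
by apply: contraTneq ke => <-.
Qed.

(** The transposition sends every triple missing from the new near-clique to one missing from the
    old. The missing triple may get filled, so [near_clique] admits complete cliques too. *)
Lemma near_clique_compress p E P i j : near_clique p E P -> i \notin P -> j \in P ->
  near_clique p (compress i j E) (tperm i j @: P).
Proof.
move=> /and4P[E3 cE /eqP cP miss] iP jP; apply/and4P; split.
- exact: compress_uniform.
- by rewrite card_compress.
- by rewrite card_imset ?cP //; apply: perm_inj.
apply: leq_trans miss.
have tinj : injective (fun f : {set I} => tperm i j @: f).
  by apply: imset_inj; apply: perm_inj.
rewrite -(card_imset _ tinj); apply/subset_leq_card/subsetP => g /imsetP[f].
rewrite in_setD => /andP[fC /drawsP[fP f3]] ->; rewrite in_setD; apply/andP; split; last first.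
  apply/drawsP; split; last by rewrite card_imset //; apply: perm_inj.
  by rewrite -[P](tperm_imsetK i j); apply: imsetS.
have jf : j \notin f.
  by apply/negP => /(subsetP fP); rewrite mem_tperm_imset tpermR (negbTE iP).
apply: contra fC => tfE; case: (boolP (f \in E)) => fE.
  by apply/imsetP; exists f => //; rewrite /compress_edge (negbTE jf).
have iif : i \in f.
  by apply: contraTT tfE => iif; rewrite tperm_imset_id.
apply/imsetP; exists (tperm i j @: f) => //; rewrite /compress_edge tperm_imsetK fE.
by rewrite !mem_tperm_imset tpermR tpermL iif jf.
Qed.

(** Among the pairs with the optimal value take [P] of largest weight. If [i] outside were heavier
    than [j] inside, compressing would preserve the value by optimality and make [P] heavier. *)
Lemma exists_heaviest_clique p E0 P0 x : near_clique p E0 P0 -> (forall k, 0 <= x k) ->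
  (forall E P, near_clique p E P -> wsum x E <= wsum x E0) ->
  exists E P, [/\ near_clique p E P, wsum x E = wsum x E0
    & forall i j, i \notin P -> j \in P -> x i <= x j].
Proof.
move=> n0 x0 xmax.
pose Q (EP : {set {set I}} * {set I}) :=
  near_clique p EP.1 EP.2 && (wsum x EP.1 == wsum x E0).
have Q0 : Q (E0, P0) by rewrite /Q n0 eqxx.
have [[E P] /andP[/= nEP /eqP wE] Pmax] :=
  arg_maxP (fun EP : {set {set I}} * {set I} => \sum_(i in EP.2) x i) Q0.
exists E, P; split=> // i j iP jP; rewrite leNgt; apply/negP => xij.
have nC := near_clique_compress nEP iP jP.
have wC : wsum x (compress i j E) = wsum x E0.
  by apply/eqP; rewrite eq_le (xmax _ _ nC) /= -wE wsum_compress // ltW.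
have := Pmax (compress i j E, tperm i j @: P); rewrite /Q /= nC wC eqxx => /(_ isT).
rewrite /= leNgt => /negP; apply.
rewrite big_imset /=; last by move=> ? ? _ _; apply: perm_inj.
rewrite (bigD1 j) //= [ltRHS](bigD1 j) //= tpermR ltr_leD //.
apply: ler_sum => k /andP[kP kj]; rewrite tpermD 1?eq_sym //.
by apply: contraTneq kP => ->.
Qed.

End Compression.

(** * Structure of the graphs attaining the optimum *)

Section ExtremalStructure.
Variables (R : realFieldType) (I : finType).
Implicit Types (A B P T e f : {set I}) (E N : {set {set I}}) (x : I -> R).

(** These triples form the clique on [P] with [w] doubled by a twin [v]: the comparison graph for
    the equality case. *)
Lemma wsum_not_both x P v w : v \notin P -> w \in P ->
  wsum x [set e in draws (v |: P) 3 | ~~ ((v \in e) && (w \in e))] =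
  espoly x 3 P + x v * espoly x 2 (P :\ w).
Proof.
move=> vP wP; have wv : w != v by apply: contraNneq vP => <-.
have vN k f : f \in draws P k -> v \notin f.
  by move=> /drawsP[fP _]; apply: contra vP => /(subsetP fP).
have -> : wsum x [set e in draws (v |: P) 3 | ~~ ((v \in e) && (w \in e))] =
  \sum_(e in draws (v |: P) 3) (if ~~ ((v \in e) && (w \in e)) then wt x e else 0).
  by rewrite -big_mkcondr; apply: eq_bigl => e; rewrite [LHS]in_set.
rewrite sum_drawsU1 //; congr (_ + _).
  by apply: eq_bigr => e /vN /negbTE ->.
rewrite mulr_sumr -big_mkcondr /=; apply: eq_big => f.
  rewrite !in_setU1 eqxx (negbTE wv) /= !inE subsetD1.
  by rewrite -!andbA; congr (_ && _); rewrite andbC.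
by case/andP=> /vN vf _; rewrite wt_U1.
Qed.

(** The comparison graph [K] has value [clique_lagrangian r] and as many edges as allowed. Each of
    its triples outweighs every triple through both [v] and [w], so a graph of no smaller value
    contains [K], hence all triples of [P]. *)
Lemma clique_of_extremal_weights x E P v w (r : R) : r = #|P|%:R -> 5 <= r ->
  (forall e, e \in E -> #|e| = 3%N) -> (#|E| <= 'C(#|P|, 3) + 'C(#|P|.-1, 2))%N ->
  (forall i, 0 <= x i) -> (forall j, j \notin v |: P -> x j = 0) ->
  v \notin P -> w \in P -> 0 < x v -> x v <= x w ->
  (forall i, i \in P -> i != w -> x i = 1 / r) -> x w + x v = 1 / r ->
  clique_lagrangian r <= wsum x E -> draws P 3 \subset E.
Proof.
move=> rP r5 E3 cE x0 xT vP wP z0 zh xA xwv ge.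
have wv : w != v by apply: contraNneq vP => <-.
have r0 : r != 0 by lra.
have ri0 : 0 < 1 / r by rewrite divr_gt0 //; lra.
pose K := [set e in draws (v |: P) 3 | ~~ ((v \in e) && (w \in e))].
pose E' := E :&: draws (v |: P) 3.
have wA f : f \subset P :\ w -> wt x f = (1 / r) ^+ #|f|.
  move=> /subsetP fA; rewrite -prodr_const; apply: eq_bigr => i /fA.
  by rewrite in_setD1 => /andP[iw iP]; apply: xA.
have cardA : #|P :\ w|%:R = r - 1 :> R by rewrite rP (cardsD1 w P) wP natrD mulr1n; lra.
have espA k : espoly x k (P :\ w) = 'C(#|P :\ w|, k)%:R * (1 / r) ^+ k.
  rewrite /espoly /wsum (eq_bigr (fun=> (1 / r) ^+ k)).
    by rewrite sumr_const card_draws_set -[LHS]mulr_natl.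
  by move=> f /drawsP[fA <-]; apply: wA.
have wK : wsum x K = clique_lagrangian r.
  rewrite wsum_not_both // -{1}(setD1K wP) espolyU1; last by rewrite in_setD1 eqxx.
  have -> : x v = 1 / r - x w by lra.
  rewrite !espA bin2R bin3R cardA /clique_lagrangian.
  by field.
have cK : #|K| = ('C(#|P|, 3) + 'C(#|P|.-1, 2))%N.
  apply/eqP; rewrite -(eqr_nat R) -wsum1 wsum_not_both // /espoly !wsum1.
  rewrite !card_draws_set mul1r natrD; apply/eqP; congr (_ + 'C(_, _)%:R).
  by rewrite (cardsD1 w P) wP.
have wt_ge e : e \in K -> x v / r ^+ 2 <= wt x e.
  rewrite [e \in K]in_set => /andP[/drawsP[eT e3]].
  have e2 c : c \in e -> #|e :\ c| = 2%N.
    by move=> ce; move/eqP: e3; rewrite (cardsD1 c) ce eqSS => /eqP.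
  case: (boolP (v \in e)) => ve /= we.
    rewrite (wt_D1 x ve) wA ?e2 // ?expr_div_n ?expr1n ?mul1r //.
    apply/subsetP => i; rewrite !in_setD1 => /andP[iv ie].
    have := subsetP eT i ie; rewrite in_setU1 (negbTE iv) /= => ->; rewrite andbT.
    by apply: contraNneq we => <-.
  have eP : e \subset P.
    apply/subsetP => i ie; have := subsetP eT i ie; rewrite in_setU1.
    by case: eqP => // iv; rewrite -iv ie in ve.
  case: (boolP (w \in e)) => we'.
    rewrite (wt_D1 x we') wA ?e2 ?setSD // expr_div_n expr1n mul1r.
    by rewrite ler_wpM2r // invr_ge0 exprn_ge0 //; lra.
  rewrite wA ?e3; last by rewrite subsetD1 eP we'.
  have -> : (1 / r) ^+ 3 = 1 / r / r ^+ 2 by field.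
  by rewrite ler_wpM2r // ?invr_ge0 ?exprn_ge0 //; lra.
have wt_out e : e \in E' :\: K -> wt x e = x v * x w / r.
  rewrite in_setD in_setI [e \in K]in_set => /andP[+ /andP[_ eD]].
  rewrite eD /= negbK => /andP[ve we]; case/drawsP: eD => eT e3.
  have wev : w \in e :\ v by rewrite in_setD1 wv.
  have e1 : #|e :\ v :\ w| = 1%N.
    by move/eqP: e3; rewrite (cardsD1 v) ve eqSS (cardsD1 w) wev eqSS => /eqP.
  rewrite (wt_D1 x ve) (wt_D1 x wev) wA ?e1; first by field.
  apply/subsetP => i; rewrite !in_setD1 => /and3P[iw iv ie].
  by have := subsetP eT i ie; rewrite in_setU1 (negbTE iv) iw.
have cE' : (#|E' :\: K| <= #|K :\: E'|)%N.
  have h : (#|E'| <= #|K|)%N.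
    by rewrite cK; apply: leq_trans cE; rewrite subset_leq_card ?subsetIl.
  by rewrite -(leq_add2l #|E' :&: K|) cardsID setIC cardsID.
have a0 : #|K :\: E'| = 0%N.
  apply/eqP; rewrite -(@pnatr_eq0 R); set a := #|K :\: E'|%:R.
  have h1 : a * (x v / r ^+ 2) <= wsum x (K :\: E').
    rewrite /a mulr_natl -sumr_const; apply: ler_sum => e.
    by rewrite in_setD => /andP[_]; apply: wt_ge.
  have h2 : wsum x (E' :\: K) <= a * (x v * x w / r).
    rewrite /wsum (eq_bigr _ wt_out) sumr_const -[leLHS]mulr_natl ler_wpM2r ?ler_nat //.
    by rewrite !mulr_ge0 ?invr_ge0 //; lra.
  have h3 : wsum x E' = wsum x E by rewrite (wsum_support xT E3).
  have h4 := wsumID x K E'; have h5 := wsumID x E' K; rewrite setIC in h5.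
  have h6 : a * (x v / r ^+ 2) <= a * (x v * x w / r) by lra.
  (* Each triple of [K] exchanged for another loses at least [x v ^+ 2 / r]. *)
  have h7 : a * (x v ^+ 2 / r) <= 0.
    have -> : a * (x v ^+ 2 / r) = a * (x v / r ^+ 2) - a * (x v * x w / r).
      have -> : x w = 1 / r - x v by lra.
      by field.
    by lra.
  rewrite eq_le ler0n andbT; move: h7; rewrite pmulr_lle0 // divr_gt0 ?exprn_gt0 //; lra.
have /eqP := a0; rewrite cards_eq0 setD_eq0 => KE; apply: subset_trans (_ : K \subset E).
  apply/subsetP => e eP; rewrite [e \in K]in_set.
  rewrite (subsetP (drawsS 3 (subsetUr [set v] P)) _ eP) /= negb_and.
  by case/drawsP: eP => eP _; rewrite (contra _ vP) // => /(subsetP eP).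
exact: subset_trans KE (subsetIl _ _).
Qed.

(** Serves twice: on an optimal graph to bound the optimum, then on the given graph, once that is
    known to be optimal, to find a clique. *)
Lemma extremal_structure p x E P : (5 <= p)%N -> near_clique p E P -> in_simplex x ->
  (forall E' P' y, near_clique p E' P' -> in_simplex y -> wsum y E' <= wsum x E) ->
  clique_lagrangian p%:R <= wsum x E ->
  wsum x E <= clique_lagrangian p%:R /\
  exists2 C : {set I}, #|C| = p & draws C 3 \subset E.
Proof.
move=> p5 nE xS xmax ge; have [x0 x1] := xS.
have r5 : 5 <= p%:R :> R by rewrite (ler_nat R 5).
have uniform E' P' : near_clique p E' P' -> forall e, e \in E' -> #|e| = 3%N.
  by move=> /and4P[/subsetP E3 _ _ _] e /E3/drawsP[].
have linkE' E' P' : near_clique p E' P' -> wsum x E' = wsum x E ->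
    forall c, 0 < x c -> 3 * wsum x E' <= link x c E'.
  move=> nE' wE' c; apply: link_ge_optimal => //; first exact: uniform nE'.
  by move=> y yS; rewrite wE'; apply: xmax nE' yS.
pose T := [set i | 0 < x i].
have memT i : (i \in T) = (0 < x i) by rewrite in_set.
have x_eq0 i : i \notin T -> x i = 0.
  by rewrite memT -leNgt => h; apply/eqP; rewrite eq_le h x0.
have [Tp|Tp] := leqP #|T| p.
  have [|wE cT TE] := small_support r5 (uniform _ _ nE) xS (linkE' _ _ nE erefl) ge memT.
    by rewrite ler_nat.
  split; first by rewrite wE.
  by exists T => //; apply/eqP; rewrite -(eqr_nat R) cT.
(* Compression alters the edges but not [x], so conclusions about the weights drawn from [E1] can be
   used for [E]. *)
have [E1 [P1 [n1 w1 top]]] :=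
  exists_heaviest_clique nE x0 (fun E' P' nE' => xmax E' P' x nE' xS).
have /and4P[_ c1 /eqP cP1 miss1] := n1.
have P1r : p%:R = #|P1|%:R :> R by rewrite cP1.
(* A weightless vertex of [P1] would make all outside vertices weightless, and the support would fit
   into [P1]. *)
have x_pos j : j \in P1 -> 0 < x j.
  move=> jP; rewrite lt_neqAle x0 andbT eq_sym; apply/negP => /eqP xj.
  move: Tp; rewrite ltnNge -cP1 => /negP; apply; apply/subset_leq_card/subsetP => i.
  rewrite memT => xi; apply: contraTT xi => iP; rewrite -leNgt -xj.
  exact: top.
have ge1 : clique_lagrangian p%:R <= wsum x E1 by rewrite w1.
have link1 := linkE' _ _ n1 w1.
have out1 : #|E1 :\: draws P1 3|%:R <= (p%:R - 1) * (p%:R - 2) / 2 + 1 :> R.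
  have h : (#|E1 :\: draws P1 3| <= 'C(p.-1, 2) + 1)%N.
    rewrite -(leq_add2l 'C(p, 3)) addnA.
    apply: leq_trans (leq_add c1 miss1).
    rewrite -{1}cP1 -card_draws_set -(cardsID E1 (draws P1 3)).
    rewrite -(cardsID (draws P1 3) E1) setIC.
    by rewrite -!addnA leq_add2l addnC.
  move: h; rewrite -(ler_nat R) natrD bin2R.
  have -> : p.-1%:R = p%:R - 1 :> R by rewrite -[in RHS](prednK (ltnW (ltnW (ltnW (ltnW p5))))) -natr1; lra.
  lra.
have [v vT vP] : exists2 v, v \in T & v \notin P1.
  apply/subsetPn; apply: contraTN Tp => /subset_leq_card; rewrite cP1 -leqNgt.
  by [].
have xv : 0 < x v by rewrite -memT.
have x_out j : j \notin v |: P1 -> x j = 0.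
  rewrite in_setU1 negb_or => /andP[jv jP]; apply/eqP/negP => xj.
  apply: (outside_pair_absurd P1r r5 (uniform _ _ n1) xS link1 ge1 top out1 vP jP).
  - by rewrite eq_sym.
  - by [].
  - by rewrite lt_neqAle x0 andbT eq_sym; apply/negP.
have xvP j : j \in P1 -> x v <= x j by move=> jP; apply: top.
have p5' : (5 <= #|P1|)%N by rewrite cP1.
rewrite -{1}cP1 -{1}[p]cP1 in c1; rewrite -w1.
have [ub eqcase] := one_outside_vertex P1r p5' (uniform _ _ n1) xS link1 ge1 x_out vP xv xvP c1 miss1.
split=> //; have [w wP [xA xwv]] := eqcase ge1.
exists P1 => //; have /and4P[_ cE _ _] := nE; rewrite -{1}cP1 -{1}[p]cP1 in cE.
exact: (clique_of_extremal_weights P1r r5 (uniform _ _ nE) cE x0 x_out vP wP xv (xvP _ wP) xA xwv ge).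
Qed.

End ExtremalStructure.

(** * Return to 3-graphs and the strict inequality *)

Lemma triple_graph_uniform (I : finType) (E : {set {set I}}) (e : {set I}) :
  e \in E :&: draws [set: I]%SET 3 -> #|e| = 3%N.
Proof. by case/setIP=> _ /drawsP[]. Qed.

(** Discards the members of [E] that are not triples. *)
Definition triple_graph n (E : {set {set 'I_n}}) : r_graph 3 n :=
  RGraph (@triple_graph_uniform _ E).

Lemma wsum_le_lagrangian (R : realType) n (G : r_graph 3 n) (y : 'I_n -> R) :
  (0 < n)%N -> in_simplex y -> wsum y (edges G) <= lagrangian R G.
Proof.
move=> n0 [y0 y1]; have [x _ [_ xmax]] := lagrangian_max R G n0.
have yS : simplex R n (\row_i y i).
  by split=> [i|]; [rewrite mxE|rewrite -y1; apply: eq_bigr => i _; rewrite mxE].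
apply: le_trans (xmax _ yS); rewrite le_eqVlt; apply/orP; left; apply/eqP.
by apply: eq_bigr => e _; apply: eq_bigr => i _; rewrite mxE.
Qed.

Lemma lagrangian_attained (R : realType) n (G : r_graph 3 n) : (0 < n)%N ->
  exists2 x : 'I_n -> R, in_simplex x & wsum x (edges G) = lagrangian R G.
Proof.
move=> n0; have [x xS [xE _]] := lagrangian_max R G n0.
by exists (fun i => x ord0 i).
Qed.

Lemma clique_lagrangian_le (R : realType) p : (0 < p)%N ->
  clique_lagrangian p%:R <= lagrangian R (complete_graph 3 p).
Proof.
move=> p0; have pn0 : p%:R != 0 :> R by rewrite pnatr_eq0 -lt0n.
have S : in_simplex (fun _ : 'I_p => p%:R^-1 : R).
  split=> [i|]; first by rewrite invr_ge0 ler0n.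
  by rewrite sumr_const card_ord -[LHS]mulr_natl divff.
apply: le_trans (wsum_le_lagrangian (complete_graph 3 p) p0 S).
have -> : edges (complete_graph 3 p) = draws [set: 'I_p]%SET 3.
  by apply/setP => e; rewrite !inE subsetT.
have -> : wsum (fun=> p%:R^-1 : R) (draws [set: 'I_p]%SET 3) =
    'C(p, 3)%:R * p%:R^-1 ^+ 3.
  rewrite /wsum (eq_bigr (fun=> p%:R^-1 ^+ 3)).
    by rewrite sumr_const card_draws_set cardsT card_ord -[LHS]mulr_natl.
  by move=> e /drawsP[_ e3]; rewrite /wt prodr_const e3.
rewrite bin3R /clique_lagrangian le_eqVlt; apply/orP; left; apply/eqP.
by field.
Qed.

Lemma contains_complete_of_clique n (G : r_graph 3 n) p (C : {set 'I_n}) :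
  #|C| = p -> draws C 3 \subset edges G -> contains G (complete_graph 3 p).
Proof.
move=> <- CG; exists enum_val; first exact: enum_val_inj.
move=> e; rewrite inE => /eqP e3; apply: (subsetP CG); apply/drawsP; split.
  by apply/subsetP => i /imsetP[j _ ->]; apply: enum_valP.
by rewrite card_imset //; apply: enum_val_inj.
Qed.

(** Only the image of the deleted edge can be missing. *)
Lemma near_clique_of_contains n (G : r_graph 3 n) p :
  (#|edges G| <= 'C(p, 3) + 'C(p.-1, 2))%N -> contains_complete_minus G p ->
  exists P, near_clique p (edges G) P.
Proof.
move=> cG [e0 _ [f finj fG]]; exists (f @: [set: 'I_p]); apply/and4P; split=> //.
- by apply/subsetP => e eG; apply/drawsP; split; [exact: subsetT|exact: edges_uniform eG].
- by rewrite card_imset // cardsT card_ord.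
apply: leq_trans (_ : (#|[set f @: e0]| <= 1)%N); last by rewrite cards1.
apply/subset_leq_card/subsetP => g.
rewrite in_setD => /andP[gG /drawsP[gP g3]]; rewrite in_set1.
have gE : g = f @: (f @^-1: g).
  apply/setP => i; apply/idP/imsetP => [ig|[j]]; last by rewrite inE => ? ->.
  have /imsetP[j _ ij] := subsetP gP i ig.
  by exists j => //; rewrite inE -ij.
apply: contraNT gG => ge; rewrite gE; apply: fG; rewrite !inE.
apply/andP; split; first by apply: contra ge => /eqP <-; rewrite -gE.
by rewrite -(card_imset _ finj) -gE g3.
Qed.

Theorem theorem3p1 (R : realType) (m t : nat) (n : nat) (G : r_graph 3 n)
    (hm : (0 < m)%N) (ht : (6 <= t)%N)
    (hm_lower : ('C(t - 1, 3) <= m)%N)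
    (hm_upper : (m <= 'C(t - 1, 3) + 'C(t - 2, 2))%N)
    (hG : #|edges G| = m)
    (hGminus : contains_complete_minus G (t - 1)%N)
    (hGfree : ~ contains G (complete_graph 3 (t - 1)%N)) :
  lagrangian R G < lagrangian R (complete_graph 3 (t - 1)%N).
Proof.
set p := (t - 1)%N in hm_upper hGminus hGfree *.
have p5 : (5 <= p)%N by rewrite /p leq_subRL ?add1n // ltnW // ltnW // ltnW // ltnW // ltnW.
have tp : (t - 2)%N = p.-1 by rewrite /p -subnS.
rewrite tp -hG in hm_upper; have [P0 nG] := near_clique_of_contains hm_upper hGminus.
have n0 : (0 < n)%N.
  have /and4P[_ _ /eqP cP _] := nG; have := max_card (mem P0).
  by rewrite cP card_ord; apply: leq_trans; apply: leq_trans p5.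
apply: lt_le_trans (clique_lagrangian_le R (leq_trans _ p5)) => //.
rewrite ltNge; apply/negP => ge.
(* On a fixed vertex set there are finitely many candidates, so an optimal one exists. *)
have [[E1 P1] /= n1 opt] := arg_maxP (P := fun EP => near_clique p EP.1 EP.2)
  (fun EP : {set {set 'I_n}} * {set 'I_n} => lagrangian R (triple_graph EP.1))
  (nG : near_clique p (edges G, P0).1 (edges G, P0).2).
have edgesE (E : {set {set 'I_n}}) P : near_clique p E P -> edges (triple_graph E) = E.
  by case/and4P=> E3 _ _ _; apply/setIidPl.
have ub (E : {set {set 'I_n}}) P y : near_clique p E P -> in_simplex y ->
    wsum y E <= lagrangian R (triple_graph E1).
  move=> nE yS; have /= := opt (E, P) nE; apply: le_trans.
  by rewrite -{1}(edgesE _ _ nE); apply: wsum_le_lagrangian.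
have [x1 x1S] := lagrangian_attained R (triple_graph E1) n0; rewrite (edgesE _ _ n1) => x1E.
have [x0 x0S x0E] := lagrangian_attained R G n0.
have ge1 : clique_lagrangian p%:R <= wsum x1 E1.
  by rewrite x1E; apply: (le_trans ge); rewrite -x0E; apply: ub nG x0S.
(* The optimum is at most [clique_lagrangian p%:R], so by the assumption [ge] the graph [G] attains
   it too and falls under the same lemma. *)
have [|le1 _] := extremal_structure p5 n1 x1S _ ge1.
  by move=> E P y nE yS; rewrite x1E; apply: ub nE yS.
have [||_ [C cC CG]] := extremal_structure p5 nG x0S.
- move=> E P y nE yS; apply: (le_trans (ub _ _ _ nE yS)).
  by rewrite -x1E x0E; apply: le_trans le1 ge.
- by rewrite x0E.
exact/hGfree/contains_complete_of_clique/CG.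
Qed.
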